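(* Let $M$ be a smooth connected manifold, $\mu$ a measure on $M$ and $(P_t)_{t\ge0}$ a semigroup on $L^2(M,\mu)$ satisfying the diffusion axioms, the smooth first-order diffusion calculus and the non-degeneracy condition described in the context, with a smooth core, and let $g$ be the recovered Riemannian metric. Then $(P_t)$ determines the weighted Riemannian manifold $(M,g,\mu)$ uniquely up to a global Riemannian isometry, and determines $\mu$ up to a global multiplicative constant on each connected component. That is, if $(\tilde\mu,(\tilde P_t))$ is another such datum on $M$ with recovered metric $\tilde g$ and with $\tilde P_tf=P_tf$ for all $t\ge0$ and $f\in C^\infty(M)$, then there is a global Riemannian isometry from $(M,g)$ onto $(M,\tilde g)$, and on each connected component of $M$ one has $\tilde\mu=c\,\mu$ for some constant $c>0$.
   Context: Setting. $M$ is a smooth connected manifold, $\mu$ a $\sigma$-finite Borel measure on $M$ with full support, and $(P_t)_{t\ge0}$ a conservative symmetric Markov $C_0$-semigroup on $L^2(M,\mu)$ with self-adjoint generator $L$, $Lf=\lim_{t\downarrow0}(P_tf-f)/t$ in $L^2(\mu)$ for $f\in\mathrm{Dom}(L)$. Its Dirichlet form is $\mathcal E(f,h)=\lim_{t\downarrow0}\frac1t\langle f-P_tf,h\rangle_{L^2(\mu)}$, with domain $\mathcal D(\mathcal E)=\{f\in L^2(\mu):\mathcal E(f,f)<\infty\}$. Diffusion axioms. (D1) $0\le f\le1\Rightarrow0\le P_tf\le1$, and $P_t1=1$. (D2) $\int_M(P_tf)h\,d\mu=\int_Mf\,(P_th)\,d\mu$ for all $f,h\in L^2(M,\mu)$.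 (D3) Strong locality: $\mathcal E(f,h)=0$ whenever $f$ is constant on a neighbourhood of $\mathrm{supp}(h)$. (D4) Regularity: $\mathcal D(\mathcal E)\cap C_c(M)$ is dense in $\mathcal D(\mathcal E)$ for the norm $(\mathcal E(f,f)+\|f\|_{L^2}^2)^{1/2}$ and dense in $C_c(M)$ for the sup norm. (D5) $\mu$ is a smooth positive measure: locally $\mu=\rho_0\,dx$ with $\rho_0\in C^\infty$, $\rho_0>0$. Carré du champ. The semigroup is taken to act on $C^\infty(M)$, and for $f,h\in C^\infty(M)$, $$\Gamma(f,h):=\lim_{t\downarrow0}\frac1{2t}\big(P_t(fh)-(P_tf)(P_th)\big),\qquad \Gamma(f):=\Gamma(f,f).$$ Smooth first-order diffusion calculus. For all $f,h\in C^\infty(M)$ this limit exists pointwise and $\Gamma(f,h)\in C^\infty(M)$; $\Gamma$ is symmetric and bilinear; $\Gamma(f,h)(x)$ depends only on $df(x),dh(x)$; $\Gamma(f,h)=0$ if $h$ is constant near $\mathrm{supp}(f)$; Leibniz rule $\Gamma(f_1f_2,h)=f_1\Gamma(f_2,h)+f_2\Gamma(f_1,h)$, and likewise in the second slot; one-variable chain rule $\Gamma(\phi\circ f,h)=\phi'(f)\Gamma(f,h)$ for every smooth $\phi:\mathbb R\to\mathbb R$, and likewise in the second slot. Smooth core. $\mathcal A\subset C^\infty(M)$ is a fixed algebra that is a dense core for $L$ (dense in $\mathrm{Dom}(L)$ for the graph norm), invariant under $(P_t)$, closed under products and under composition with smooth functions, with $\mathcal A\subset\mathrm{Dom}(L)$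 and $L\mathcal A\subset\mathcal A$. Non-degeneracy condition. For every $x\in M$ the bilinear form on $T_x^*M$ given by $(df(x),dh(x))\mapsto\Gamma(f,h)(x)$ is positive definite. Recovered metric. The unique smooth Riemannian metric $g$ on $M$ with $\Gamma(f,h)=\langle df,dh\rangle_{g^{-1}}$ for all $f,h\in C^\infty(M)$, where $\langle\cdot,\cdot\rangle_{g^{-1}}$ is the inner product on $T^*M$ dual to $g$. The recovered weighted Riemannian manifold is $(M,g,\mu)$. *)

(* Defs.v *)
From HB Require Import structures.
From mathcomp Require Import all_boot all_order all_algebra.
From mathcomp Require Import all_classical all_reals all_analysis.

Set Implicit Arguments.
Unset Strict Implicit.
Unset Printing Implicit Defensive.

Import Order.TTheory GRing.Theory Num.Theory.
Import numFieldNormedType.Exports.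

Local Open Scope classical_set_scope.
Local Open Scope ring_scope.

Notation borel T := (g_sigma_algebraType (@open T)).

Section euclidean.
Context {R : realType} {n : nat}.

Definition basis_vector (i : 'I_n) : 'rV[R]_n := delta_mx 0 i.

(* All partial derivatives of order at most k exist and are continuous on the
   open set U. The values of f outside U are irrelevant. *)
Fixpoint C_on (k : nat) (U : set 'rV[R]_n) (f : 'rV[R]_n -> R) : Prop :=
  (forall y, U y -> {for y, continuous f}) /\
  if k is k'.+1 then
    forall i, (forall y, U y -> derivable f y (basis_vector i)) /\
              C_on k' U (fun y => 'D_(basis_vector i) f y)
  else True.

Definition smooth_on (U : set 'rV[R]_n) (f : 'rV[R]_n -> R) : Prop :=
  forall k, C_on k U f.

Definition smooth_map_on (m : nat) (U : set 'rV[R]_n)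
    (f : 'rV[R]_n -> 'rV[R]_m) : Prop :=
  forall j, smooth_on U (fun y => f y 0 j).

(* Lebesgue measure on R^n is the unique Borel measure that gives every box its
   elementary volume. *)
Definition is_lebesgue_measure
    (lam : {measure set (borel 'rV[R]_n) -> \bar R}) : Prop :=
  forall a b : 'rV[R]_n, (forall i, a 0 i <= b 0 i) ->
    lam [set y : 'rV[R]_n | forall i, a 0 i <= y 0 i <= b 0 i] =
    (\prod_(i < n) (b 0 i - a 0 i))%:E.

End euclidean.

Definition smooth_real {R : realType} (phi : R -> R) : Prop :=
  forall k x, derivable (derive1n k phi) x 1.

(* chart_map and chart_inv are total functions, but only their restrictions to
   chart_dom and to its image matter. *)
Record chart (R : realType) (n : nat) (T : topologicalType) := Chart {
  chart_dom : set T ;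
  chart_map :> T -> 'rV[R]_n ;
  chart_inv : 'rV[R]_n -> T ;
  chart_dom_open : open chart_dom ;
  chart_img_open : open (chart_map @` chart_dom) ;
  chart_mapK : forall x, chart_dom x -> chart_inv (chart_map x) = x ;
  chart_map_continuous :
    forall x, chart_dom x -> {for x, continuous chart_map} ;
  chart_inv_continuous :
    forall y, (chart_map @` chart_dom) y -> {for y, continuous chart_inv}
}.

Definition chart_img R n T (c : chart R n T) : set 'rV[R]_n :=
  c @` chart_dom c.

Record manifold (R : realType) (n : nat) := Manifold {
  carrier :> ptopologicalType ;
  atlas : set (chart R n carrier) ;
  manifold_hausdorff : hausdorff_space carrier ;
  manifold_second_countable : @second_countable carrier ;
  atlas_cover : forall x : carrier, exists2 c, atlas c & chart_dom c x ;
  atlas_compatible : forall c d, atlas c -> atlas d ->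
    smooth_map_on (c @` (chart_dom c `&` chart_dom d)) (d \o chart_inv c)
}.

Section smooth_structure.
Context {R : realType} {n : nat} (M : manifold R n).

Definition smooth (f : M -> R) : Prop :=
  forall c, atlas c -> smooth_on (chart_img c) (f \o chart_inv c).

(* The components of df(x) in the basis dx_1, ..., dx_n of the chart c. *)
Definition differential (c : chart R n M) (f : M -> R) (x : M) : 'rV[R]_n :=
  \row_i 'D_(basis_vector i) (f \o chart_inv c) (c x).

(* df(x) = dh(x) as elements of the cotangent space at x. *)
Definition eq_differential (x : M) (f h : M -> R) : Prop :=
  forall c, atlas c -> chart_dom c x -> differential c f x = differential c h x.

Definition supp (f : M -> R) : set M := closure [set x | f x != 0].

Definition compactly_supported_continuous (f : M -> R) : Prop :=
  continuous f /\ compact (supp f).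

Definition constant_near (A : set M) (f : M -> R) : Prop :=
  exists (U : set M) (a : R),
    [/\ open U, A `<=` U & forall x, U x -> f x = a].

(* The jacobian follows the row vector convention: a tangent vector with
   components v in c has components v *m 'J in d. *)
Record riemannian_metric := RiemannianMetric {
  metric_mx :> chart R n M -> M -> 'M[R]_n ;
  metric_smooth : forall c, atlas c -> forall i j,
    smooth_on (chart_img c) (fun y => metric_mx c (chart_inv c y) i j) ;
  metric_sym : forall c x, atlas c -> chart_dom c x ->
    (metric_mx c x)^T = metric_mx c x ;
  metric_posdef : forall c x, atlas c -> chart_dom c x ->
    forall v : 'rV[R]_n, v != 0 -> 0 < (v *m metric_mx c x *m v^T) 0 0 ;
  metric_tensorial : forall c d x, atlas c -> atlas d ->
    chart_dom c x -> chart_dom d x ->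
    let J := jacobian (d \o chart_inv c) (c x) in
    metric_mx c x = J *m metric_mx d x *m J^T
}.

(* <df, dh>_{g^-1} at x, computed in the chart c. *)
Definition dual_metric (g : riemannian_metric) (c : chart R n M)
    (f h : M -> R) (x : M) : R :=
  (differential c f x *m invmx (g c x) *m (differential c h x)^T) 0 0.

Definition smooth_self_map (F : M -> M) : Prop :=
  continuous F /\
  forall c d, atlas c -> atlas d ->
    smooth_map_on (c @` (chart_dom c `&` F @^-1` chart_dom d))
                  (d \o F \o chart_inv c).

(* The last clause is F^* g' = g in local coordinates. *)
Definition riemannian_isometry (g g' : riemannian_metric) (F : M -> M) : Prop :=
  [/\ smooth_self_map F,
      exists G, [/\ smooth_self_map G, cancel F G & cancel G F] &
      forall c d x, atlas c -> atlas d -> chart_dom c x -> chart_dom d (F x) ->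
        let J := jacobian (d \o F \o chart_inv c) (c x) in
        g c x = J *m g' d (F x) *m J^T].

End smooth_structure.

(* A semigroup is a single family of operators on functions. It is constrained
   on two classes of functions only: on square integrable functions, where all
   the laws hold almost everywhere, and on smooth functions, where they hold
   pointwise. Hence P t f, for f smooth and square integrable, is the smooth
   representative of the class of P t f in L^2. *)

Section diffusion.
Context {R : realType} {n : nat} {M : manifold R n}.
Variable mu : {measure set (borel M) -> \bar R}.
Variable P : R -> (M -> R) -> (M -> R).

Definition L2 : set (M -> R) := [set f | (f : borel M -> R) \in Lfun mu 2%:E].

Definition L2norm (f : M -> R) : \bar R :=
  'N[mu]_2%:E [EFin \o (f : borel M -> R)].

Definition L2dot (f h : M -> R) : R :=
  \int[mu]_(x in [set: borel M]) (f x * h x).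

(* "f is in Dom(L) and L f = u". *)
Definition generator (f u : M -> R) : Prop :=
  [/\ L2 f, L2 u &
      L2norm (fun x => t^-1 * (P t f x - f x) - u x) @[t --> 0^'+] --> 0%E].

Definition self_adjoint (L : (M -> R) -> (M -> R) -> Prop) : Prop :=
  (forall f (e : R), L2 f -> 0 < e ->
     exists u v, L u v /\ (L2norm (f - u)%R < e%:E)%E) /\
  (forall f w, L2 f -> L2 w ->
     (L f w <-> forall u v, L u v -> L2dot v f = L2dot u w)).

Definition dirichlet_form (f h : M -> R) : \bar R :=
  lim ((t^-1 * L2dot (f - P t f) h)%:E @[t --> 0^'+]).

Definition dirichlet_domain : set (M -> R) :=
  [set f | L2 f /\ (dirichlet_form f f < +oo)%E].

Definition energy_norm (f : M -> R) : \bar R :=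
  ((dirichlet_form f f + L2norm f ^+ 2) `^ 2^-1)%E.

(* The support of a class of functions modulo almost everywhere equality. *)
Definition ess_supp (f : M -> R) : set M :=
  ~` \bigcup_(U in [set U : set M | open U /\
        {ae mu, forall x, U x -> f x = 0}]) U.

Definition ae_constant_near (A : set M) (f : M -> R) : Prop :=
  exists (U : set M) (a : R),
    [/\ open U, A `<=` U & {ae mu, forall x, U x -> f x = a}].

Definition strongly_local : Prop :=
  forall f h, dirichlet_domain f -> dirichlet_domain h ->
    ae_constant_near (ess_supp h) f -> dirichlet_form f h = 0%E.

Definition regular : Prop :=
  (forall f (e : R), dirichlet_domain f -> 0 < e ->
     exists h, [/\ dirichlet_domain h, compactly_supported_continuous h &
                   (energy_norm (f - h)%R < e%:E)%E]) /\
  (forall f (e : R), compactly_supported_continuous f -> 0 < e ->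
     exists h, [/\ dirichlet_domain h, compactly_supported_continuous h &
                   forall x, `|f x - h x| <= e]).

Definition smooth_positive_measure : Prop :=
  exists2 lam : {measure set (borel 'rV[R]_n) -> \bar R},
    is_lebesgue_measure lam &
    forall c : chart R n M, atlas c ->
    exists rho0 : 'rV[R]_n -> R,
      [/\ smooth_on (chart_img c) rho0,
          forall y, chart_img c y -> 0 < rho0 y &
          forall B : set (borel M), measurable B -> B `<=` chart_dom c ->
            (mu B = \int[lam]_(y in (c @` B)%classic) (rho0 y)%:E)%E].

Definition full_support : Prop :=
  forall U : set M, open U -> U !=set0 -> (0 < mu (U : set (borel M)))%E.

Record C0_semigroup_L2 : Prop := {
  semigroup_L2 : forall t f, 0 <= t -> L2 f -> L2 (P t f) ;
  semigroup_L2_linear : forall t a f h, 0 <= t -> L2 f -> L2 h ->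
    {ae mu, forall x, P t (a *: f + h) x = a * P t f x + P t h x} ;
  semigroup_L2_bounded : forall t, 0 <= t ->
    exists C : R, forall f, L2 f -> (L2norm (P t f) <= C%:E * L2norm f)%E ;
  semigroup_L2_0 : forall f, L2 f -> {ae mu, forall x, P 0 f x = f x} ;
  semigroup_L2_D : forall s t f, 0 <= s -> 0 <= t -> L2 f ->
    {ae mu, forall x, P (s + t) f x = P s (P t f) x} ;
  semigroup_L2_continuous : forall f, L2 f ->
    L2norm (P t f - f) @[t --> 0^'+] --> 0%E
}.

Record acts_on_smooth : Prop := {
  semigroup_smooth : forall t f, 0 <= t -> smooth f -> smooth (P t f) ;
  semigroup_smooth_linear : forall t a f h, 0 <= t -> smooth f -> smooth h ->
    P t (a *: f + h) = a *: P t f + P t h ;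
  semigroup_smooth_0 : forall f, smooth f -> P 0 f = f ;
  semigroup_smooth_D : forall s t f, 0 <= s -> 0 <= t -> smooth f ->
    P (s + t) f = P s (P t f)
}.

Record conservative_markov : Prop := {
  markov_L2 : forall t f, 0 <= t -> L2 f ->
    {ae mu, forall x, 0 <= f x <= 1} -> {ae mu, forall x, 0 <= P t f x <= 1} ;
  markov_smooth : forall t f, 0 <= t -> smooth f ->
    (forall x, 0 <= f x <= 1) -> forall x, 0 <= P t f x <= 1 ;
  conservative : forall t, 0 <= t -> P t (cst 1) = cst 1
}.

Definition symmetric_semigroup : Prop :=
  forall t f h, 0 <= t -> L2 f -> L2 h -> L2dot (P t f) h = L2dot f (P t h).

Definition carre_du_champ (f h : M -> R) (x : M) : R :=
  lim ((2 * t)^-1 * (P t (f * h) x - P t f x * P t h x) @[t --> 0^'+]).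

Local Notation Gamma := carre_du_champ.

Record smooth_diffusion_calculus : Prop := {
  Gamma_cvg : forall f h x, smooth f -> smooth h ->
    cvg ((2 * t)^-1 * (P t (f * h) x - P t f x * P t h x) @[t --> 0^'+]) ;
  Gamma_smooth : forall f h, smooth f -> smooth h -> smooth (Gamma f h) ;
  Gamma_sym : forall f h, smooth f -> smooth h -> Gamma f h = Gamma h f ;
  Gamma_linear_l : forall a f1 f2 h, smooth f1 -> smooth f2 -> smooth h ->
    Gamma (a *: f1 + f2) h = a *: Gamma f1 h + Gamma f2 h ;
  Gamma_linear_r : forall a f h1 h2, smooth f -> smooth h1 -> smooth h2 ->
    Gamma f (a *: h1 + h2) = a *: Gamma f h1 + Gamma f h2 ;
  Gamma_first_order : forall x f1 f2 h1 h2,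
    smooth f1 -> smooth f2 -> smooth h1 -> smooth h2 ->
    eq_differential x f1 f2 -> eq_differential x h1 h2 ->
    Gamma f1 h1 x = Gamma f2 h2 x ;
  Gamma_local : forall f h, smooth f -> smooth h ->
    constant_near (supp f) h -> Gamma f h = 0 ;
  Gamma_leibniz_l : forall f1 f2 h, smooth f1 -> smooth f2 -> smooth h ->
    Gamma (f1 * f2) h = f1 * Gamma f2 h + f2 * Gamma f1 h ;
  Gamma_leibniz_r : forall f h1 h2, smooth f -> smooth h1 -> smooth h2 ->
    Gamma f (h1 * h2) = h1 * Gamma f h2 + h2 * Gamma f h1 ;
  Gamma_chain_l : forall (phi : R -> R) f h,
    smooth_real phi -> smooth f -> smooth h ->
    Gamma (phi \o f) h = (derive1 phi \o f) * Gamma f h ;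
  Gamma_chain_r : forall (phi : R -> R) f h,
    smooth_real phi -> smooth f -> smooth h ->
    Gamma f (phi \o h) = (derive1 phi \o h) * Gamma f h
}.

(* Every covector at x is a df(x), so this is positive definiteness on the
   whole cotangent space. *)
Definition nondegenerate : Prop :=
  forall x f, smooth f -> ~ eq_differential x f 0 -> 0 < Gamma f f x.

Record smooth_core (A : set (M -> R)) : Prop := {
  core_smooth : forall f, A f -> smooth f ;
  core_0 : A 0 ;
  core_linear : forall a f h, A f -> A h -> A (a *: f + h) ;
  core_mul : forall f h, A f -> A h -> A (f * h) ;
  core_comp : forall (phi : R -> R) f, smooth_real phi -> A f -> A (phi \o f) ;
  core_semigroup : forall t f, 0 <= t -> A f -> A (P t f) ;
  core_generator : forall f, A f -> exists2 u, A u & generator f u ;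
  core_dense : forall f u (e : R), generator f u -> 0 < e ->
    exists a b, [/\ A a, generator a b &
                    (L2norm (f - a)%R + L2norm (u - b)%R < e%:E)%E]
}.

Record diffusion (A : set (M -> R)) : Prop := {
  diffusion_full_support : full_support ;
  diffusion_C0 : C0_semigroup_L2 ;
  diffusion_self_adjoint : self_adjoint generator ;
  diffusion_smooth : acts_on_smooth ;
  diffusion_markov : conservative_markov ;
  diffusion_symmetric : symmetric_semigroup ;
  diffusion_local : strongly_local ;
  diffusion_regular : regular ;
  diffusion_measure : smooth_positive_measure ;
  diffusion_calculus : smooth_diffusion_calculus ;
  diffusion_nondegenerate : nondegenerate ;
  diffusion_core : smooth_core A
}.

Definition recovered_metric (g : riemannian_metric M) : Prop :=
  forall f h, smooth f -> smooth h ->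
  forall c x, atlas c -> chart_dom c x -> Gamma f h x = dual_metric g c f h x.

End diffusion.

(* Main.v *)
(** The isometry is the identity. Since P' = P on smooth functions, Gamma' =
    Gamma; and the functions (y_i - a_i) b, for b a bump function in a chart,
    have differentials spanning the cotangent space at the centre a, so that
    Gamma determines the inverse metric.

    For the measures, let theta be the smooth positive density of mu' with
    respect to mu. As P_t is symmetric for mu and for mu' = theta mu, it
    commutes with the multiplication by theta on compactly supported smooth
    functions h: P_t (theta h) = theta P_t h. By the definition of Gamma this
    gives Gamma(theta, theta h) = theta Gamma(theta, h), and the Leibniz rule
    leaves h Gamma(theta, theta) = 0. By non-degeneracy d theta = 0, so theta
    is constant. *)
Require Import Defs.
From mathcomp Require Import all_boot all_order all_algebra.
From mathcomp Require Import all_classical all_reals all_analysis.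
From mathcomp Require Import measurable_realfun.
From mathcomp Require Import ring lra.
Import Order.TTheory GRing.Theory Num.Theory.
Import numFieldNormedType.Exports.
Local Open Scope classical_set_scope.
Local Open Scope ring_scope.

Set Implicit Arguments.
Unset Strict Implicit.
Unset Printing Implicit Defensive.

(** * Functions of class C^k on open sets of R^n *)

Section C_on_theory.
Context {R : realType} {n : nat}.
Implicit Types (U V : set 'rV[R]_n) (f g : 'rV[R]_n -> R).

(** Symmetry speaks of square integrable functions, but [theta] need not be one, and P_t does not
    preserve supports. Every test function is therefore supported in a compact box of a single
    chart, which has finite measure for both measures, and the identity P_t (theta h) = theta P_t h
    is read off at the centre of that box only. In Gamma(theta, theta h) the semigroup acts on
    [theta] merely as on a smooth function; commutation is applied to h and to theta h, both
    supported in the box.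

    The function [theta] has to be built. Each measure has a density in each chart, with respect to
    a Lebesgue measure of its own. Uniqueness of Lebesgue measure makes the two densities
    comparable. Their ratio is independent of the chart because it is governed by mu'(V) / mu(V) for
    small open sets V, where full support keeps the denominator positive; no change of variables
    formula is involved. *)

Lemma C_on_continuous k U f y : C_on k U f -> U y -> {for y, continuous f}.
Proof. by case: k => [|k] [+ _] => /[apply]. Qed.

Lemma C_on_derivable k U f y i :
  C_on k.+1 U f -> U y -> derivable f y (basis_vector i).
Proof. by move=> [_ /(_ i)[+ _]] => /[apply]. Qed.

Lemma C_on_local k U f :
  (forall y, U y -> exists2 V, V y & C_on k V f) -> C_on k U f.
Proof.
elim: k f => [|k IH] f loc.
  by split=> // y /loc[V Vy /C_on_continuous]; exact.
split; first by move=> y /loc[V Vy /C_on_continuous]; exact.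
move=> i; split; first by move=> y /loc[V Vy /C_on_derivable]; exact.
by apply: IH => y /loc[V Vy [_ /(_ i)[_ CV]]]; exists V.
Qed.

Lemma C_onW k U f : C_on k.+1 U f -> C_on k U f.
Proof.
elim: k f => [|k IH] f [cf Df]; split=> // i.
by have [df /IH] := Df i.
Qed.

Lemma near_open U (Q : 'rV[R]_n -> Prop) y :
  open U -> U y -> (forall z, U z -> Q z) -> \forall z \near y, Q z.
Proof. by move=> oU Uy UQ; apply: filterS UQ _; exact: open_nbhs_nbhs. Qed.

Lemma C_on_ext k U f g :
  open U -> (forall y, U y -> f y = g y) -> C_on k U f -> C_on k U g.
Proof.
move=> oU; elim: k f g => [|k IH] f g fg [cf Df].
  split=> // y Uy.
  have fgy : \forall z \near y, f z = g z by exact: near_open Uy fg.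
  change (g @ y --> g y); rewrite -fg//.
  exact: cvg_trans (near_eq_cvg fgy) (cf y Uy).
split.
  move=> y Uy; have fgy : \forall z \near y, f z = g z by exact: near_open Uy fg.
  change (g @ y --> g y); rewrite -fg//.
  exact: cvg_trans (near_eq_cvg fgy) (cf y Uy).
move=> i; have [df Cf] := Df i; split.
  move=> y Uy; apply: near_eq_derivable (df y Uy).
  exact: near_open Uy fg.
apply: IH Cf => y Uy; apply: near_eq_derive.
exact: near_open Uy fg.
Qed.

Lemma C_on_cst k U (a : R) : C_on k U (cst a).
Proof.
elim: k a => [|k IH] a; split=> //; try by move=> y _; exact: cst_continuous.
move=> i; split; first by move=> y _; exact: derivable_cst.
have -> : 'D_(basis_vector i) (cst a : 'rV[R]_n -> R) = cst 0.
  by apply/funext => y; rewrite derive_cst.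
exact: IH.
Qed.

Lemma is_derive_coord (y v : 'rV[R]_n) j :
  is_derive y v (fun z => z 0 j) (v 0 j).
Proof.
have E : \forall h \near (0 : R)^',
    v 0 j = h^-1 *: (((fun z : 'rV[R]_n => z 0 j) \o shift y) (h *: v) - y 0 j).
  near=> h; have h0 : h != 0 by near: h; exact: nbhs_dnbhs_neq.
  by rewrite /= !mxE addrK /GRing.scale/= mulKf.
have H : h^-1 *: (((fun z : 'rV[R]_n => z 0 j) \o shift y) (h *: v) - y 0 j)
    @[h --> (0 : R)^'] --> v 0 j.
  exact: cvg_trans (near_eq_cvg E) (cvg_cst (v 0 j)).
by split; [exact: cvgP H|exact: cvg_lim H].
Unshelve. all: by end_near. Qed.

Lemma C_onD k U f g : open U -> C_on k U f -> C_on k U g -> C_on k U (f + g).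
Proof.
move=> oU; elim: k f g => [|k IH] f g [cf Df] [cg Dg]; split=> //.
- by move=> y Uy; exact: continuousD (cf y Uy) (cg y Uy).
- by move=> y Uy; exact: continuousD (cf y Uy) (cg y Uy).
move=> i; have [df Cf] := Df i; have [dg Cg] := Dg i; split.
  by move=> y Uy; apply: derivableD; [exact: df|exact: dg].
apply: C_on_ext (IH _ _ Cf Cg) => // y Uy /=.
by rewrite deriveD//; [exact: df|exact: dg].
Qed.

Lemma C_onM k U f g : open U -> C_on k U f -> C_on k U g -> C_on k U (f * g).
Proof.
move=> oU; elim: k f g => [|k IH] f g Cf0 Cg0.
  by split=> // y Uy; exact: continuousM (Cf0.1 y Uy) (Cg0.1 y Uy).
have [cf Df] := Cf0; have [cg Dg] := Cg0.
split; first by move=> y Uy; exact: continuousM (cf y Uy) (cg y Uy).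
move=> i; have [df Cf] := Df i; have [dg Cg] := Dg i; split.
  by move=> y Uy; apply: derivableM; [exact: df|exact: dg].
apply: (@C_on_ext _ _ (f * (fun y => 'D_(basis_vector i) g y) +
                       g * (fun y => 'D_(basis_vector i) f y))) => //.
  by move=> y Uy /=; rewrite deriveM//; [exact: df|exact: dg].
by apply: C_onD => //; apply: IH => //; exact: C_onW.
Qed.

(** The derivative of 1/f is -(1/f)(1/f) f', where 1/f occurs again but only has to be of class C^k,
    which the induction provides. *)
Lemma C_onV k U f : open U -> (forall y, U y -> f y != 0) ->
  C_on k U f -> C_on k U (fun y => (f y)^-1).
Proof.
move=> oU f0; elim: k => [|k IH] Cf0.
  by split=> // y Uy; exact: continuousV (f0 y Uy) (Cf0.1 y Uy).
have [cf Df] := Cf0.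
split; first by move=> y Uy; exact: continuousV (f0 y Uy) (cf y Uy).
move=> i; have [df Cf] := Df i; split.
  by move=> y Uy; apply: derivableV; [exact: f0|exact: df].
have CV := IH (C_onW Cf0).
apply: (@C_on_ext _ _ (cst (-1) * ((fun y => (f y)^-1) * (fun y => (f y)^-1)) *
   (fun y => 'D_(basis_vector i) f y))) => //.
  move=> y Uy /=; rewrite deriveV//; [|exact: f0|exact: df].
  by rewrite -[LHS]/(-1 * ((f y)^-1 * (f y)^-1) * 'D_(basis_vector i) f y)
    mulN1r -expr2 exprVn.
by do 2 apply: C_onM => //; [exact: C_on_cst|exact: C_onM].
Qed.

Lemma derive_line f (y v : 'rV[R]_n) :
  'D_1 (fun h : R => f (h *: v + y)) (0 : R) = 'D_v f y.
Proof.
rewrite /derive.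
suff -> : (fun h : R => h^-1 *: (((fun h : R => f (h *: v + y)) \o
    shift (0 : R)) (h *: (1 : R)) - f (0 *: v + y))) =
  (fun h => h^-1 *: ((f \o shift y) (h *: v) - f y)) by [].
by apply/funext => h /=; rewrite scale0r add0r addr0 /GRing.scale/= mulr1.
Qed.

(** A directional derivative is the derivative at 0 of the restriction to a line, so the
    one-variable chain rule applies and only derivability of [f] along [v] is involved. *)
Lemma is_derive_comp (F : R -> R) f (y v : 'rV[R]_n) (a b : R) :
  is_derive (f y) 1 F a -> is_derive y v f b ->
  is_derive y v (F \o f) (a * b).
Proof.
move=> dF df.
pose p (h : R) := f (h *: v + y).
have p0 : p 0 = f y by rewrite /p scale0r add0r.
have dp : is_derive (0 : R) 1 p b.
  have [/derivable1P df1 <-] := df; split; first exact df1.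
  exact: derive_line.
have dFp : is_derive (0 : R) 1 (F \o p) (a * b).
  by apply: is_derive1_comp; rewrite p0.
have [dFp1 <-] := dFp; split; first by apply/derivable1P; exact dFp1.
by rewrite -derive_line.
Qed.

End C_on_theory.

(** * The function exp(-1/s), extended by 0 to s <= 0 *)

Section flat_exponential.
Context {R : realType}.

(* Derivatives of exp(-1/s) are combinations of the members of this family,
   which is therefore closed under differentiation. *)
Definition flat_exp (m : nat) (s : R) : R :=
  if 0 < s then s ^- m * expR (- s^-1) else 0.

Lemma flat_exp_ge0 m s : 0 <= flat_exp m s.
Proof.
rewrite /flat_exp; case: ifP => // s0.
by rewrite mulr_ge0 ?expR_ge0// invr_ge0 exprn_ge0// ltW.
Qed.

(** The term of degree m+2 in the exponential series bounds exp(1/s) from below by s^-(m+2) /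
    (m+2)!. The two powers beyond m leave the factor s^2, which is what derivability at 0 asks
    for. *)
Lemma flat_exp_le m s : flat_exp m s <= (m.+2)`!%:R * s ^+ 2.
Proof.
rewrite /flat_exp; case: ifP => s0; last by rewrite mulr_ge0// sqr_ge0.
have si : 0 <= s^-1 by rewrite invr_ge0 ltW.
have := expR_ge1Dxn m.+1 si; rewrite expRN => H.
have H1 : s^-1 ^+ m.+2 / (m.+2)`!%:R <= expR s^-1.
  by apply: le_trans H; rewrite ler_wpDl.
have f0 : 0 < (m.+2)`!%:R :> R by rewrite ltr0n fact_gt0.
rewrite ler_pdivrMr ?expR_gt0//.
have -> : s ^- m = (m.+2)`!%:R * s ^+ 2 * (s^-1 ^+ m.+2 / (m.+2)`!%:R).
  have s1 : s != 0 by rewrite gt_eqF.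
  by rewrite -exprVn !exprS; field; rewrite s1 gt_eqF.
by rewrite ler_wpM2l// mulr_ge0// ?sqr_ge0 ?ltW.
Qed.

Lemma is_derive0_quadratic (f : R -> R) (C : R) :
  (forall s, `|f s| <= C * s ^+ 2) -> is_derive (0 : R) 1 f 0.
Proof.
move=> fC; have f0 : f 0 = 0.
  by apply/eqP; rewrite -normr_le0 (le_trans (fC 0))// expr0n mulr0.
apply/is_derive1_caratheodory; exists (fun z => f z / z); split.
- move=> z; rewrite f0 !subr0; have [->|z0] := eqVneq z 0.
    by rewrite f0 mulr0.
  by rewrite divfK.
- suff H : (fun z => f z / z) @ (0 : R) --> (0 : R).
    by change ((fun z => f z / z) @ (0 : R) --> f 0 / 0); rewrite f0 mul0r.
  apply/cvgrPdist_le => e e0.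
  have C0 : 0 <= C by have := fC 1; rewrite expr1n mulr1; apply: le_trans.
  (* [C] may be 0, hence the denominator [C + 1]. *)
  have d0 : 0 < e / (C + 1) by rewrite divr_gt0// ltr_wpDl.
  near=> z; have [->|z0] := eqVneq z 0.
    by rewrite invr0 mulr0 subr0 normr0 ltW.
  have zd : `|z| <= e / (C + 1) by near: z; exact: (@cvgr0_norm_le _ _ _ _ _ id).
  rewrite sub0r normrN normrM normfV ler_pdivrMr ?normr_gt0// (le_trans (fC z))//.
  rewrite -real_normK ?num_real// expr2 mulrA ler_wpM2r//.
  apply: (@le_trans _ _ (C * (e / (C + 1)))); first by rewrite ler_wpM2l.
  have C1 : 0 < C + 1 by rewrite ltr_wpDl.
  rewrite mulrCA -[leRHS]mulr1 ler_wpM2l ?(ltW e0)//.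
  by rewrite ler_pdivrMr// mul1r lerDl.
- by rewrite f0 mul0r.
Unshelve. all: by end_near. Qed.

Lemma is_derive_near_eq (f g : R -> R) (s a : R) :
  (\near s, f s = g s) -> is_derive s 1 f a -> is_derive s 1 g a.
Proof.
move=> fg df; have [df1 dfE] := df; split.
  exact: near_eq_derivable fg df1.
by rewrite -(near_eq_derive _ fg).
Qed.

(** For s > 0 this is the product rule. At 0, where the right-hand side vanishes, it follows from
    the quadratic bound. *)
Lemma is_derive_flat_exp (m : nat) (s : R) : is_derive s 1 (flat_exp m)
  (- m%:R * flat_exp m.+1 s + flat_exp m.+2 s).
Proof.
have [s0|s0|<-] := ltgtP 0 s.
- have sn0 : s != 0 by rewrite gt_eqF.
  have dV : is_derive s 1 (fun s : R => s^-1) (- s ^- 2).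
    have := @is_deriveV R id s 1 1 sn0 (is_derive_id _ _).
    by rewrite /GRing.scale/= mulr1.
  have dX : is_derive s 1 (fun s : R => s ^- m) (- (m%:R * s ^- m.+1)).
    have -> : (fun s : R => s ^- m) = (fun s : R => s^-1) ^+ m.
      by apply/funext => t; rewrite fctE/= exprVn.
    have d := @is_deriveX _ _ (fun s : R => s^-1) m s _ _ dV.
    apply: is_derive_eq; rewrite /GRing.scale/=.
    case: m {d} => [|m]; first by rewrite !mul0r oppr0.
    by rewrite /= -!exprVn !exprS; ring.
  have dE : is_derive s 1 (fun s => expR (- s^-1)) (expR (- s^-1) * s ^- 2).
    apply: (@is_derive1_comp _ expR (fun s => - s^-1)).
    have := is_deriveN dV; rewrite opprK; exact.
  have dM := is_deriveM dX dE.
  apply: (@is_derive_near_eq ((fun s : R => s ^- m) * (fun s => expR (- s^-1)))).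
    near=> t; have t0 : 0 < t by near: t; exact: lt_nbhsr.
    by rewrite /flat_exp t0.
  apply: is_derive_eq; rewrite /flat_exp s0 /GRing.scale/= -!exprVn !exprS.
  ring.
- have -> : - m%:R * flat_exp m.+1 s + flat_exp m.+2 s = 0.
    by rewrite /flat_exp ltNge ltW//= mulr0 addr0.
  apply: (@is_derive_near_eq (cst 0)).
  near=> t; have t0 : t < 0 by near: t; exact: lt_nbhsl.
  by rewrite /flat_exp ltNge ltW.
- have -> : - m%:R * flat_exp m.+1 0 + flat_exp m.+2 0 = 0.
    by rewrite /flat_exp ltxx mulr0 addr0.
  apply: (@is_derive0_quadratic _ (m.+2)`!%:R) => t.
  by rewrite ger0_norm ?flat_exp_ge0// flat_exp_le.
Unshelve. all: by end_near. Qed.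

Lemma continuous_flat_exp (m : nat) : continuous (flat_exp m : R -> R).
Proof.
move=> s; apply: differentiable_continuous; apply/derivable1_diffP.
by have [] := is_derive_flat_exp m s.
Qed.

(** The induction on [k] is for all [m] at once, since a derivative of [flat_exp m] involves the
    indices [m.+1] and [m.+2]. *)
Lemma C_on_flat_exp {n : nat} k m (U : set 'rV[R]_n) (f : 'rV[R]_n -> R) :
  open U -> C_on k U f -> C_on k U (flat_exp m \o f).
Proof.
move=> oU; elim: k m => [|k IH] m Cf0.
  split=> // y Uy; apply: continuous_comp; first exact: (Cf0.1 y Uy).
  exact: continuous_flat_exp.
have [cf Df] := Cf0; split.
  move=> y Uy; apply: continuous_comp; first exact: cf.
  exact: continuous_flat_exp.
move=> i; have [df Cf] := Df i.
have dcomp y : U y -> is_derive y (basis_vector i) (flat_exp m \o f)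
    ((- m%:R * flat_exp m.+1 (f y) + flat_exp m.+2 (f y)) *
     'D_(basis_vector i) f y).
  move=> Uy; apply: is_derive_comp; first exact: is_derive_flat_exp.
  by apply: derivableP; exact: df.
split; first by move=> y /dcomp[].
apply: (@C_on_ext _ _ _ _ ((cst (- m%:R) * (flat_exp m.+1 \o f) +
   (flat_exp m.+2 \o f)) * (fun y => 'D_(basis_vector i) f y))) => //.
  by move=> y /dcomp[_ ->].
apply: C_onM => //; apply: C_onD => //; last exact: IH (C_onW Cf0).
by apply: C_onM => //; [exact: C_on_cst|exact: IH (C_onW Cf0)].
Qed.

End flat_exponential.

(** * Bump functions on a manifold *)

Section boxes.
Context {R : realType} {n : nat}.
Implicit Types (a y : 'rV[R]_n) (U : set 'rV[R]_n).

(** Closed balls of the sup norm: they are compact, and as products of segments they carry bump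
    functions that are products of one-variable functions. *)
Definition box a (r : R) : set 'rV[R]_n :=
  [set y | forall i, `|y 0 i - a 0 i| <= r].

Lemma box_compact a r : compact (box a r).
Proof.
have := @rV_compact R n (fun i => `[a 0 i - r, a 0 i + r]%classic)
  (fun i => @segment_compact R (a 0 i - r) (a 0 i + r)).
congr compact; apply/seteqP; split => y /= + i => /(_ i); rewrite in_itv/=.
  by rewrite ler_distl.
by rewrite ler_distl.
Qed.

Lemma box_nbhs a r : 0 < r -> nbhs a (box a r).
Proof.
move=> r0; apply/nbhs_ballP; exists r => //= y [_ ay] i.
by rewrite distrC ltW//; exact: ay.
Qed.

Lemma open_box U a : open U -> U a -> exists2 r : R, 0 < r & box a r `<=` U.
Proof.
move=> oU Ua; have /nbhs_ballP[e /= e0 eU] : nbhs a U by exact: open_nbhs_nbhs.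
exists (e / 2); first by rewrite divr_gt0.
move=> y ay; apply: eU; split=> // i j; rewrite (ord1 i).
change (`|a 0 j - y 0 j| < e).
by rewrite distrC (le_lt_trans (ay j))// ltr_pdivrMr// ltr_pMr// ltr1n.
Qed.

Lemma is_derive_line (f : 'rV[R]_n -> R) a (v : 'rV[R]_n) (t : R) :
  derivable f (t *: v + a) v ->
  is_derive t 1 (fun h : R => f (h *: v + a)) ('D_v f (t *: v + a)).
Proof.
move=> df.
have E : (fun h : R => h^-1 *: (((fun h : R => f (h *: v + a)) \o shift t)
    (h *: (1 : R)) - f (t *: v + a))) =
  (fun h => h^-1 *: ((f \o shift (t *: v + a)) (h *: v) - f (t *: v + a))).
  apply/funext => h /=; rewrite [h *: 1]mulr1 scalerDl addrA//.
by split; rewrite /derivable /derive E.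
Qed.

Lemma eq_on_segment (p : R -> R) (u v : R) : u <= v ->
  (forall t, u <= t <= v -> is_derive t 1 p 0) -> p u = p v.
Proof.
rewrite le_eqVlt => /predU1P[->//|uv] dp.
have [|t|c cuv] := @MVT R p (fun=> 0) u v uv.
- by move=> t; rewrite in_itv/= => /andP[/ltW ut /ltW tv]; apply: dp; rewrite ut.
- apply: continuous_in_subspaceT => {}t; rewrite inE/= in_itv/= => /dp[d _].
  by apply: differentiable_continuous; exact/derivable1_diffP.
- by rewrite mul0r => /eqP; rewrite subr_eq0 => /eqP.
Qed.

(** The path from [a] to [y] that changes one coordinate at a time stays in the box, and each of its
    segments is parallel to an axis, so the mean value theorem needs partial derivatives only. The
    point [z k] has the first [k] coordinates of [y] and the others of [a]. *)
Lemma eq_on_box (f : 'rV[R]_n -> R) a (r : R) y : 0 < r -> box a r y ->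
  (forall z i, box a r z -> derivable f z (basis_vector i)) ->
  (forall z i, box a r z -> 'D_(basis_vector i) f z = 0) -> f y = f a.
Proof.
move=> r0 ay df Df.
pose z k : 'rV[R]_n := \row_i (if (i < k)%N then y 0 i else a 0 i).
have zn : z n = y by apply/rowP => i; rewrite mxE ltn_ord.
have z0 : z 0%N = a by apply/rowP => i; rewrite mxE.
suff zk k : (k <= n)%N -> f (z k) = f a by rewrite -zn zk.
elim: k => [|k IH] kn; first by rewrite z0.
rewrite -IH ?(ltnW kn)//.
pose i0 := Ordinal kn; pose s := y 0 i0 - a 0 i0.
have zS : z k.+1 = s *: basis_vector i0 + z k.
  apply/rowP => i; rewrite !mxE eqxx/= ltnS leq_eqVlt.
  have [ik|ik] := eqVneq i i0.
    by rewrite ik /= eqxx ltnn /= mulr1 subrK.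
  have /negbTE -> : (i != k :> nat).
    by apply: contra ik => /eqP ik; apply/eqP/val_inj.
  by rewrite mulr0 add0r.
have bz (t : R) : `|t| <= `|s| -> box a r (t *: basis_vector i0 + z k).
  move=> ts i; rewrite !mxE eqxx/=; have [->|ik] := eqVneq i i0.
    by rewrite /= ?eqxx ltnn mulr1 addrK; exact: le_trans ts (ay i0).
  rewrite mulr0 add0r; case: ifP => _; first exact: ay.
  by rewrite subrr normr0 ltW.
have dp (t : R) : `|t| <= `|s| -> is_derive t 1
    (fun h : R => f (h *: basis_vector i0 + z k)) 0.
  by move=> /bz tb; rewrite -(Df _ i0 tb); exact: is_derive_line (df _ _ tb).
have -> : z k = 0 *: basis_vector i0 + z k by rewrite scale0r add0r.
rewrite zS; have [s0|s0] := leP 0 s.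
  apply/esym/(@eq_on_segment (fun h => f (h *: basis_vector i0 + z k)) _ _ s0).
  by move=> t /andP[t0 ts]; apply: dp; rewrite !ger0_norm.
apply: (@eq_on_segment (fun h => f (h *: basis_vector i0 + z k)) _ _ (ltW s0)).
by move=> t /andP[st t0]; apply: dp; rewrite !ler0_norm ?lerN2// ltW.
Qed.

End boxes.

Section charts.
Context {R : realType} {n : nat} {T : topologicalType} (c : chart R n T).

Lemma chart_invK y : chart_img c y -> c (chart_inv c y) = y.
Proof. by move=> [x cx <-]; rewrite chart_mapK. Qed.

Lemma chart_inv_dom y : chart_img c y -> chart_dom c (chart_inv c y).
Proof. by move=> [x cx <-]; rewrite chart_mapK. Qed.

Lemma chart_img_map x : chart_dom c x -> chart_img c (c x).
Proof. by exists x. Qed.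

(** Seen as a preimage under the continuous inverse chart, the image of an open or measurable set is
    open or measurable. *)
Lemma chart_imageE (W : set T) : c @` (chart_dom c `&` W) =
  chart_img c `&` chart_inv c @^-1` W.
Proof.
apply/seteqP; split => [_ [x [cx Wx] <-]|y [yc Wy]].
  by split; [exact: chart_img_map|rewrite /= chart_mapK].
by exists (chart_inv c y); [split=> //; exact: chart_inv_dom|exact: chart_invK].
Qed.

Lemma open_chart_image (W : set T) : open W -> open (c @` (chart_dom c `&` W)).
Proof.
move=> oW; rewrite chart_imageE openE => y [yc Wy]; apply: filterI.
  by apply: open_nbhs_nbhs; split=> //; exact: chart_img_open.
apply: chart_inv_continuous => //; exact: open_nbhs_nbhs.
Qed.

Lemma near_chart_dom x : chart_dom c x -> \forall z \near x, chart_dom c z.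
Proof. by move=> cx; apply: open_nbhs_nbhs; split=> //; exact: chart_dom_open. Qed.

Lemma chart_box_compact a r : box a r `<=` chart_img c ->
  compact (chart_inv c @` box a r).
Proof.
move=> ac; apply: continuous_compact; last exact: box_compact.
apply: continuous_in_subspaceT => y; rewrite inE => /ac.
exact: chart_inv_continuous.
Qed.

End charts.

Section smooth_functions.
Context {R : realType} {n : nat} {M : manifold R n}.
Implicit Types (f h : M -> R) (c d : chart R n M).

Lemma smooth_continuous f : smooth f -> continuous f.
Proof.
move=> sf x; have [c ac cx] := atlas_cover x.
have cf : {for c x, continuous (f \o chart_inv c)}.
  exact: C_on_continuous (sf c ac 0%N) (chart_img_map cx).
have cfc := @continuous_comp _ _ _ c _ x (chart_map_continuous cx) cf.
have E : \forall z \near x, ((f \o chart_inv c) \o c) z = f z.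
  by near do rewrite /= chart_mapK//; exact: near_chart_dom.
change (f @ x --> f x).
have -> : f x = ((f \o chart_inv c) \o c) x by rewrite /= chart_mapK.
apply: cvg_trans cfc; apply: near_eq_cvg.
exact: E.
Unshelve. all: by end_near. Qed.

Lemma smooth_cst (a : R) : smooth (cst a : M -> R).
Proof. by move=> c _ k; exact: C_on_cst. Qed.

Lemma smoothD f h : smooth f -> smooth h -> smooth (f + h).
Proof.
move=> sf sh c ac k.
exact (C_onD (@chart_img_open _ _ _ c) (sf c ac k) (sh c ac k)).
Qed.

Lemma smoothM f h : smooth f -> smooth h -> smooth (f * h).
Proof.
move=> sf sh c ac k.
exact (C_onM (@chart_img_open _ _ _ c) (sf c ac k) (sh c ac k)).
Qed.

Lemma smoothB f h : smooth f -> smooth h -> smooth (f - h).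
Proof.
move=> sf sh; have -> : f - h = f + cst (-1) * h.
  by apply/funext => x; rewrite -[RHS]/(f x + -1 * h x) mulN1r.
by apply: smoothD => //; apply: smoothM => //; exact: smooth_cst.
Qed.

(** [W] and the complement of [K] are open and cover the manifold; [f] is smooth on the one and zero
    on the other. *)
Lemma smooth_extend_by_zero (K W : set M) f : closed K -> open W -> K `<=` W ->
  (forall x, ~ K x -> f x = 0) ->
  (forall d, atlas d -> smooth_on (d @` (chart_dom d `&` W)) (f \o chart_inv d)) ->
  smooth f.
Proof.
move=> cK oW KW f0 sf d ad k; apply: C_on_local => _ [x dx <-].
have [Wx|Wx] := pselect (W x).
  by exists (d @` (chart_dom d `&` W)); [exists x|exact: sf].
exists (d @` (chart_dom d `&` ~` K)); first by exists x => //; split=> // /KW.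
apply: (@C_on_ext _ _ _ _ (cst 0)); last exact: C_on_cst.
  by apply: open_chart_image; exact: closed_openC.
by move=> y; rewrite chart_imageE => -[_ /= Ky]; rewrite f0.
Qed.

End smooth_functions.

Section bump.
Context {R : realType} {n : nat} {M : manifold R n}.
Variables (c : chart R n M) (a : 'rV[R]_n) (r : R).
Hypotheses (ac : atlas c) (r0 : 0 < r) (ar : box a r `<=` chart_img c).

Let K := chart_inv c @` box a r.

(** The two arguments are the signed distances of y_i to the faces a_i - r and a_i + r, so the
    product is positive inside the box and 0 elsewhere. They are written with sums and products by
    constants, to which the stability lemmas for [C_on] apply directly. *)
Definition flat_bump (y : 'rV[R]_n) : R :=
  \prod_i (flat_exp 0 (y 0 i + (r - a 0 i)) * flat_exp 0 (-1 * y 0 i + (a 0 i + r))).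

Definition bump (x : M) : R :=
  if x \in chart_dom c then flat_bump (c x) else 0.

Lemma bump_ge0 x : 0 <= bump x.
Proof.
rewrite /bump; case: ifP => // _; apply: prodr_ge0 => i _.
by rewrite mulr_ge0// flat_exp_ge0.
Qed.

Lemma bump_center_gt0 x : chart_dom c x -> c x = a -> 0 < bump x.
Proof.
move=> cx xa; rewrite /bump mem_set// xa; apply: prodr_gt0 => i _.
have e : a 0 i + (r - a 0 i) = r by rewrite addrC subrK.
have e' : -1 * a 0 i + (a 0 i + r) = r by rewrite mulN1r addKr.
by rewrite e e' /flat_exp r0 expr0 invr1 mul1r mulr_gt0// expR_gt0.
Qed.

Lemma bump_out x : ~ K x -> bump x = 0.
Proof.
rewrite /bump; case: ifPn => // /set_mem cx Kx.
have /existsNP[i /negP] : ~ box a r (c x).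
  by move=> bx; apply: Kx; exists (c x) => //; exact: chart_mapK.
rewrite ler_distl negb_and -!ltNge => /orP ri.
rewrite /flat_bump (bigD1 i)//=.
suff -> : flat_exp 0 (c x 0 i + (r - a 0 i)) *
  flat_exp 0 (-1 * c x 0 i + (a 0 i + r)) = 0 by rewrite mul0r.
rewrite /flat_exp; case: ifPn => [h1|_]; last by rewrite mul0r.
case: ifPn => [h2|_]; last by rewrite mulr0.
by exfalso; case: ri => ri; lra.
Qed.

(** [K] is compact in a Hausdorff space, hence closed in the whole manifold and not just in the
    chart domain. Extension by zero depends on this. *)
Lemma bump_support_closed : closed K.
Proof.
apply: compact_closed; first exact: manifold_hausdorff.
exact: chart_box_compact.
Qed.

Lemma bump_support_dom : K `<=` chart_dom c.
Proof. by move=> _ [y /ar yc <-]; exact: chart_inv_dom. Qed.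

Lemma smooth_in_chart (phi : 'rV[R]_n -> R) (f : M -> R) :
  (forall d k, atlas d -> let U := d @` (chart_dom d `&` chart_dom c) in
    C_on k U (phi \o (c \o chart_inv d))) ->
  (forall x, chart_dom c x -> f x = phi (c x)) ->
  (forall x, ~ K x -> f x = 0) -> smooth f.
Proof.
move=> Cphi fphi f0.
apply: (@smooth_extend_by_zero _ _ _ K (chart_dom c)) => //.
- exact: bump_support_closed.
- exact: chart_dom_open.
- exact: bump_support_dom.
move=> d ad k; apply: C_on_ext (Cphi d k ad).
  by apply: open_chart_image; exact: chart_dom_open.
by move=> y; rewrite chart_imageE => -[_ /= cy]; rewrite fphi.
Qed.

Lemma C_on_flat_bump k m (U : set 'rV[R]_m) (u : 'rV[R]_m -> 'rV[R]_n) :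
  open U -> smooth_map_on U u -> C_on k U (flat_bump \o u).
Proof.
move=> oU su.
have -> : flat_bump \o u = \prod_i
    ((flat_exp 0 \o ((fun y => u y 0 i) + cst (r - a 0 i))) *
     (flat_exp 0 \o (cst (-1) * (fun y => u y 0 i) + cst (a 0 i + r)))).
  apply/funext => y; rewrite /flat_bump /=; symmetry.
  by elim/big_rec2: _ => // i x1 x2 _ <-.
elim/big_ind: _ => [|f g Cf Cg|i _]; first exact: C_on_cst.
  exact: C_onM.
apply: C_onM => //; apply: C_on_flat_exp => //; apply: C_onD => //.
- exact: su.
- exact: C_on_cst.
- by apply: C_onM => //; [exact: C_on_cst|exact: su].
- exact: C_on_cst.
Qed.

Lemma open_overlap (d : chart R n M) : open (d @` (chart_dom d `&` chart_dom c)).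
Proof. by apply: open_chart_image; exact: chart_dom_open. Qed.

Lemma bump_smooth : smooth bump.
Proof.
apply: (@smooth_in_chart flat_bump).
- move=> d k ad U; apply: C_on_flat_bump; first exact: open_overlap.
  exact: atlas_compatible.
- by move=> x cx; rewrite /bump mem_set.
- exact: bump_out.
Qed.

Definition bump_coord (i : 'I_n) (x : M) : R := (c x 0 i - a 0 i) * bump x.

Lemma bump_coord_smooth i : smooth (bump_coord i).
Proof.
apply: (@smooth_in_chart (fun y => (y 0 i + - a 0 i) * flat_bump y)).
- move=> d k ad U.
  have oU : open U by exact: open_overlap.
  apply: (@C_onM _ _ _ _ ((fun y => (c \o chart_inv d) y 0 i) + cst (- a 0 i))
                 (flat_bump \o (c \o chart_inv d))) => //.
    apply: C_onD => //; last exact: C_on_cst.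
    exact: atlas_compatible.
  apply: C_on_flat_bump => //; exact: atlas_compatible.
- by move=> x cx; rewrite /bump_coord /bump mem_set.
- by move=> x Kx; rewrite /bump_coord bump_out ?mulr0.
Qed.

(** In the product rule the derivative of the bump comes with the factor y_i - a_i, which vanishes
    at the centre. *)
Lemma differential_bump_coord i x : chart_dom c x -> c x = a ->
  differential c (bump_coord i) x = bump x *: basis_vector i.
Proof.
move=> cx xa; apply/rowP => j; rewrite !mxE eqxx/=.
have ya : chart_img c a by rewrite -xa; exact: chart_img_map.
have db : derivable (bump \o chart_inv c) a (basis_vector j).
  by apply: C_on_derivable ya; exact: (bump_smooth ac 1%N).
rewrite xa; pose p : 'rV[R]_n -> R := (fun y => y 0 i) + cst (- a 0 i).
have dp : is_derive a (basis_vector j) p ((j == i)%:R).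
  have := is_deriveD (is_derive_coord a (basis_vector j) i)
    (is_derive_cst (- a 0 i : R) a (basis_vector j)).
  by rewrite addr0 mxE eqxx/= eq_sym.
have [dp1 dp2] := dp.
have -> : 'D_(basis_vector j) (bump_coord i \o chart_inv c) a =
    'D_(basis_vector j) (p * (bump \o chart_inv c)) a.
  apply: near_eq_derive; apply: near_open ya _; first exact: chart_img_open.
  by move=> y yc; rewrite /bump_coord /= chart_invK.
rewrite deriveM// dp2 -[p a]/(a 0 i + - a 0 i) subrr scale0r add0r.
by have -> : x = chart_inv c a by rewrite -xa chart_mapK.
Qed.

End bump.

(** A level set is closed by continuity, and open because [f] read in a chart is constant on a box
    around each point. *)
Lemma constant_of_differential (R : realType) (n : nat) (M : manifold R n)
    (f : M -> R) : connected [set: M] -> smooth f ->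
  (forall c x, atlas c -> chart_dom c x -> differential c f x = 0) ->
  forall x y, f x = f y.
Proof.
move=> conM sf df x y; have cf := smooth_continuous sf.
suff H : [set z | f z = f y] = [set: M].
  have : [set: M] x by []. by rewrite -H.
apply: conM; first by exists y.
- exists [set z | f z = f y]; last by rewrite setTI.
  rewrite openE => z /= zy; have [c ac cz] := atlas_cover z.
  have [r r0 rc] := open_box (@chart_img_open _ _ _ c) (chart_img_map cz).
  have zb : \forall w \near z, chart_dom c w /\ box (c z) r (c w).
    apply: filterI; first exact: near_chart_dom.
    by apply: (chart_map_continuous cz); exact: box_nbhs.
  apply: filterS zb => w [cw bw]; rewrite /= -zy.
  have := @eq_on_box _ _ (f \o chart_inv c) _ _ _ r0 bw.
  rewrite /= !chart_mapK//; apply.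
    move=> u i /rc uc; exact: C_on_derivable (sf c ac 1%N) uc.
  move=> u i /rc uc; have := df c (chart_inv c u) ac (chart_inv_dom uc).
  by move=> /rowP/(_ i); rewrite !mxE chart_invK.
- exists [set z | f z = f y]; last by rewrite setTI.
  have -> : [set z | f z = f y] = f @^-1` [set f y] by [].
  apply: closed_comp; first by move=> z _; exact: cf.
  exact: closed_eq.
Qed.

(** * Lebesgue measure and integration against a density *)

Section lebesgue_uniqueness.
Context {R : realType} {n : nat}.

Definition closed_box (a b : 'rV[R]_n) : set 'rV[R]_n :=
  [set y | forall i, a 0 i <= y 0 i <= b 0 i].

(* The empty set is added so that the family is stable by intersection. *)
Definition closed_boxes : set (set (borel 'rV[R]_n)) :=
  [set B | B = set0 \/
    exists a b : 'rV[R]_n, (forall i, a 0 i <= b 0 i) /\ B = closed_box a b].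

Lemma box_closed_box (a : 'rV[R]_n) r :
  box a r = closed_box (a - const_mx r) (a + const_mx r).
Proof.
by apply/seteqP; split => y /= + i => /(_ i); rewrite !mxE ler_distl.
Qed.

Lemma closed_boxes_box (a : 'rV[R]_n) r : 0 <= r -> closed_boxes (box a r).
Proof.
move=> r0; right; exists (a - const_mx r), (a + const_mx r); split.
  by move=> i; rewrite !mxE; lra.
exact: box_closed_box.
Qed.

Lemma closed_borel (T : ptopologicalType) (A : set T) : closed A ->
  measurable (A : set (borel T)).
Proof.
move=> cA; rewrite -[A]setCK; apply: measurableC; apply: sub_sigma_algebra.
exact: closed_openC.
Qed.

Lemma open_borel (T : ptopologicalType) (A : set T) : open A ->
  measurable (A : set (borel T)).
Proof. by move=> oA; exact: sub_sigma_algebra. Qed.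

Lemma closed_closed_box (a b : 'rV[R]_n) : closed (closed_box a b).
Proof.
apply: compact_closed; first exact: norm_hausdorff.
have := @rV_compact R n (fun i => `[a 0 i, b 0 i]%classic)
  (fun i => @segment_compact R (a 0 i) (b 0 i)).
by congr compact; apply/seteqP; split => y /= + i => /(_ i); rewrite in_itv.
Qed.

Lemma closed_boxes_measurable : closed_boxes `<=` measurable.
Proof.
move=> _ [->|[a [b [_ ->]]]]; first exact: measurable0.
by apply: closed_borel; exact: closed_closed_box.
Qed.

Lemma closed_boxes_setI : setI_closed closed_boxes.
Proof.
move=> A B [->|[a [b [ab ->]]]] HB; first by left; rewrite set0I.
case: HB => [->|[a' [b' [ab' ->]]]]; first by left; rewrite setI0.
pose a2 : 'rV[R]_n := \row_i Num.max (a 0 i) (a' 0 i).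
pose b2 : 'rV[R]_n := \row_i Num.min (b 0 i) (b' 0 i).
have E : closed_box a b `&` closed_box a' b' = closed_box a2 b2.
  apply/seteqP; split => [y [h1 h2] i|y h].
    move: (h1 i) (h2 i) => /andP[h3 h4] /andP[h5 h6].
    by rewrite !mxE ge_max le_min h3 h4 h5 h6.
  by split=> i; move: (h i); rewrite !mxE ge_max le_min =>
    /andP[/andP[h3 h5] /andP[h4 h6]]; apply/andP.
have [h|/existsNP[i hi]] := pselect (forall i, a2 0 i <= b2 0 i).
  by right; exists a2, b2.
left; change (closed_box a b `&` closed_box a' b' = set0); rewrite E.
apply/seteqP; split => // y /(_ i) /andP[h1 h2].
by apply: hi; exact: le_trans h2.
Qed.

Lemma rat_approx (x e : R) : 0 < e -> exists q : rat, `|x - ratr q| <= e.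
Proof.
move=> e0; have /rat_in_itvoo[q] : x - e < x + e by lra.
rewrite in_itv/= => /andP[q1 q2]; exists q.
by rewrite ler_distl; apply/andP; split; lra.
Qed.

Lemma approx_trans (x y q e r : R) :
  `|x - q| <= e -> `|y - q| <= e -> e <= r / 2 -> `|x - y| <= r.
Proof.
rewrite !ler_distl => /andP[? ?] /andP[? ?] ?.
by apply/andP; split; lra.
Qed.

(** [U] is the union of the boxes it contains whose centre is rational and whose radius is of the
    form 1/(k+1). These are countably many, enumerated through [unpickle]; indices that give no such
    box contribute the empty set. *)
Lemma closed_boxes_open (U : set 'rV[R]_n) : open U -> <<s closed_boxes >> U.
Proof.
move=> oU.
pose B (p : 'rV[rat]_n * nat) := box (map_mx (@ratr R) p.1) p.2.+1%:R^-1.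
pose F k := if unpickle k is Some p then
  (if `[< B p `<=` U >] then B p else set0) else set0.
have -> : U = \bigcup_k F k.
  apply/seteqP; split => [y Uy|y [k _]]; last first.
    rewrite /F; case: unpickle => // p; case: asboolP => //; exact.
  have [r r0 rU] := open_box oU Uy.
  (* Two points of a box of radius at most r/2 are at distance at most r, so a small rational box
     containing [y] lies in [U]. *)
  have [k /ltW kr] : exists k : nat, (k.+1%:R^-1 : R) < r / 2.
    have [|k hk] := @ltr_add_invr R 0 (r / 2); first by rewrite divr_gt0.
    by exists k; rewrite add0r in hk.
  have k0 : 0 < (k.+1%:R^-1 : R) by rewrite invr_gt0 ltr0n.
  have q_ (i : 'I_n) := rat_approx (y 0 i) k0.
  pose q : 'rV[rat]_n := \row_i projT1 (cid (q_ i)).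
  have qy i : `|y 0 i - ratr (q 0 i)| <= k.+1%:R^-1.
    by rewrite mxE; case: (cid (q_ i)).
  exists (pickle (q, k)) => //; rewrite /F pickleK.
  have BU : B (q, k) `<=` U.
    move=> z Bz; apply: rU => i.
    have := Bz i; rewrite mxE => /approx_trans; apply; [exact: qy|exact: kr].
  rewrite asboolT// => i; rewrite mxE; exact: qy.
apply: sigma_algebra_bigcup => k; apply: sub_sigma_algebra.
rewrite /F; case: unpickle => [p|]; last by left.
case: asboolP => _; last by left.
by apply: closed_boxes_box; rewrite invr_ge0.
Qed.

(** Each smooth positive measure comes with its own Lebesgue measure; this allows the densities of
    two such measures to refer to the same one. The closed boxes are stable under intersection,
    generate the Borel sets, and exhaust the space by sets of finite measure. *)
Lemma lebesgue_measure_unique_rV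
    (lam lam' : {measure set (borel 'rV[R]_n) -> \bar R}) :
  is_lebesgue_measure lam -> is_lebesgue_measure lam' ->
  forall B : set (borel 'rV[R]_n), measurable B -> lam B = lam' B.
Proof.
move=> Hl Hl' B mB.
apply: (@g_sigma_algebra_measure_unique _ _ _ closed_boxes _
  (fun k => box 0 k%:R)).
- exact: closed_boxes_measurable.
- by move=> k; exact: closed_boxes_box.
- apply/seteqP; split => // y _.
  exists (Num.bound (\sum_i `|y 0 i|)) => // i; rewrite !mxE subr0.
  apply/ltW/le_lt_trans; last first.
    apply: archi_boundP; exact: sumr_ge0.
  by rewrite (bigD1 i)//= lerDl sumr_ge0.
- exact: closed_boxes_setI.
- move=> _ [->|[a [b [ab ->]]]]; first by rewrite !measure0.
  by rewrite Hl// Hl'.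
- move=> k; rewrite box_closed_box [ltLHS]Hl ?ltry//.
  by move=> i; rewrite !mxE; have := ler0n R k; lra.
- move: mB; apply: smallest_sub; first exact: smallest_sigma_algebra.
  exact: closed_boxes_open.
Qed.

End lebesgue_uniqueness.

Section density.
Context {d d' : measure_display} {T : measurableType d} {Y : measurableType d'}.
Context {R : realType}.
Local Open Scope ereal_scope.
Import HBNNSimple.

(** On [D], [nu] is the image under [phi] of the measure with density [theta] on [E], so this is a
    change of variables and a change of density in one. Monotone convergence reduces it to simple
    functions, linearity to indicators, and for these it is the hypothesis on [nu]. *)
Lemma ge0_integral_density (nu : {measure set T -> \bar R})
    (mu : {measure set Y -> \bar R}) (D : set T) (E : set Y) (phi : Y -> T)
    (theta : Y -> R) (F : T -> \bar R) :
  measurable D -> measurable E ->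
  measurable_fun E phi -> (forall y, E y -> D (phi y)) ->
  measurable_fun E theta -> (forall y, E y -> (0 <= theta y)%R) ->
  (forall B, measurable B -> B `<=` D ->
     nu B = \int[mu]_(y in E `&` phi @^-1` B) (theta y)%:E) ->
  measurable_fun D F -> (forall x, D x -> 0 <= F x) ->
  \int[nu]_(x in D) F x = \int[mu]_(y in E) (F (phi y) * (theta y)%:E).
Proof.
move=> mD mE mphi phiD mt t0 nuE mF F0.
have mtE : measurable_fun E (EFin \o theta) by exact/measurable_EFinP.
pose f_ := nnsfun_approx mD mF.
have mf_ k : measurable_fun E (EFin \o f_ k \o phi).
  apply: (@measurable_comp _ _ _ _ _ _ setT) => //.
  by apply/measurable_EFinP; exact: measurable_funTS.
transitivity (limn (fun k => \int[nu]_(x in D) (f_ k x)%:E)).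
  rewrite -monotone_convergence//.
  - apply: eq_integral => y /[!inE] yD; apply/esym/cvg_lim => //.
    exact: cvg_nnsfun_approx.
  - by move=> k; apply/measurable_EFinP; exact: measurable_funTS.
  - by move=> k y _; rewrite lee_fin.
  - by move=> y _ m k mk; rewrite lee_fin; exact/lefP/nd_nnsfun_approx.
transitivity (limn (fun k =>
    \int[mu]_(y in E) ((f_ k (phi y))%:E * (theta y)%:E))); last first.
  rewrite -monotone_convergence//.
  - apply: eq_integral => y /[!inE] Ey; apply/cvg_lim => //.
    by apply: cvgeZr => //; apply: cvg_nnsfun_approx => //; exact: phiD.
  - by move=> k; exact (emeasurable_funM (mf_ k) mtE).
  - by move=> k y Ey; rewrite mule_ge0 ?lee_fin ?t0.
  - move=> y Ey m k mk; rewrite lee_wpmul2r ?lee_fin ?t0//.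
    exact/lefP/nd_nnsfun_approx.
congr (limn _); apply/funext => k.
have mfr r : measurable (f_ k @^-1` [set r]) by [].
have mindic_ r : measurable_fun E (fun y => \1_(f_ k @^-1` [set r]) (phi y) : R).
  apply: (@measurableT_comp _ _ _ _ _ _ (\1_(f_ k @^-1` [set r]) : T -> R)) => //.
transitivity (\sum_(r \in range (f_ k))
    (r%:E * \int[mu]_(y in E `&` phi @^-1` (D `&` f_ k @^-1` [set r]))
              (theta y)%:E)).
  under eq_integral do rewrite fimfunE -fsumEFin//.
  rewrite ge0_integral_fsum//; last 2 first.
  - by move=> y; exact/measurable_EFinP/measurable_funM.
  - by move=> y x _; rewrite nnfun_muleindic_ge0.
  apply: eq_fsbigr => r _; rewrite integralZl_indic_nnsfun// integral_indic//=.
  by rewrite setIC nuE//; exact: measurableI.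
transitivity (\sum_(r \in range (f_ k))
    (\int[mu]_(y in E)
       ((r * \1_(f_ k @^-1` [set r]) (phi y))%:E * (theta y)%:E))).
  apply: eq_fsbigr => r /[!inE] -[x0 _ <-].
  under [RHS]eq_integral do rewrite EFinM -muleA.
  rewrite ge0_integralZl//; last 3 first.
  - apply: emeasurable_funM => //; apply/measurable_EFinP.
    exact: mindic_.
  - by move=> y Ey; rewrite mule_ge0// lee_fin ?t0.
  - by rewrite lee_fin.
  congr (_ * _); rewrite integral_mkcondr; apply: eq_integral => y /[!inE] Ey.
  have phiE s : (y \in phi @^-1` (D `&` f_ k @^-1` [set s])) =
      (phi y \in f_ k @^-1` [set s]).
    apply/idP/idP => /set_mem h; apply/mem_set; first by case: h.
    by split=> //; exact: phiD.
  by rewrite patchE/= indicE phiE; case: ifPn => _; rewrite ?mul1e ?mul0e.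
rewrite -ge0_integral_fsum//.
- apply: eq_integral => y /[!inE] Ey.
  rewrite [in RHS]fimfunE -fsumEFin//.
  rewrite -ge0_mule_fsuml//.
  by move=> r; rewrite nnfun_muleindic_ge0.
- move=> r; apply: emeasurable_funM => //; apply/measurable_EFinP.
  by apply: measurable_funM => //; exact: mindic_.
- by move=> r y Ey; rewrite mule_ge0 ?nnfun_muleindic_ge0// lee_fin t0.
Qed.

End density.

Section borel_measurability.

Lemma open_preimage_on (T U : topologicalType) (E : set T) (f : T -> U)
    (V : set U) : open E -> (forall x, E x -> {for x, continuous f}) ->
  open V -> open (E `&` f @^-1` V).
Proof.
move=> oE cf oV; rewrite openE => x [Ex Vx]; apply: filterI.
  exact: open_nbhs_nbhs.
by apply: cf => //; exact: open_nbhs_nbhs.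
Qed.

Lemma measurable_fun_borel (T U : ptopologicalType) (E : set T) (f : T -> U) :
  open E -> (forall x, E x -> {for x, continuous f}) ->
  measurable_fun (E : set (borel T)) (f : borel T -> borel U).
Proof.
move=> oE cf; apply: (@measurability _ _ (borel T) (borel U) E f
  (@open U : set (set (borel U)))).
  by [].
by move=> _ [V oV <-]; apply: open_borel; exact: open_preimage_on.
Qed.

Lemma measurable_fun_borel_real (R : realType) (T : ptopologicalType)
    (E : set T) (f : T -> R) :
  open E -> (forall x, E x -> {for x, continuous f}) ->
  measurable_fun (E : set (borel T)) (f : borel T -> R).
Proof.
move=> oE cf; apply: (@measurability _ _ (borel T) _ E f _
  (RGenOInfty.measurableE R)).
move=> _ [_ [a ->] <-]; apply: open_borel; apply: open_preimage_on => //.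
Qed.

End borel_measurability.

Lemma compact_bound (R : realType) (T : topologicalType) (K : set T) (f : T -> R) :
  compact K -> (forall x, K x -> {for x, continuous f}) ->
  exists2 C, 0 <= C & forall x, K x -> `|f x| <= C.
Proof.
move=> cK cf; have /compact_bounded[C [_ HC]] : compact (f @` K).
  apply: continuous_compact => //; apply: continuous_in_subspaceT => x.
  by rewrite inE => /cf.
exists (`|C| + 1); first by rewrite addr_ge0.
by move=> x Kx; apply: HC; [rewrite ltr_pwDr// ler_norm|exists x].
Qed.

(** * Measures with a smooth density in a chart *)

Section chart_measure.
Context {R : realType} {n : nat} {M : manifold R n}.
Implicit Types (mu : {measure set (borel M) -> \bar R}) (c : chart R n M).
Implicit Types (lam : {measure set (borel 'rV[R]_n) -> \bar R}).
Implicit Types (rho : 'rV[R]_n -> R).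

Local Notation bdom c := (chart_dom c : set (borel M)).
Local Notation bimg c := (chart_img c : set (borel 'rV[R]_n)).

(** The condition that [smooth_positive_measure] imposes on one chart, with the Lebesgue measure as
    a parameter so that two measures can share it. *)
Definition chart_density mu lam c rho : Prop :=
  [/\ smooth_on (chart_img c) rho,
      forall y, chart_img c y -> 0 < rho y &
      forall B : set (borel M), measurable B -> B `<=` chart_dom c ->
        (mu B = \int[lam]_(y in (c @` B)%classic) (rho y)%:E)%E].

Lemma chart_dom_measurable c : measurable (chart_dom c : set (borel M)).
Proof. by apply: open_borel; exact: chart_dom_open. Qed.

Lemma chart_density_integral mu lam c rho (F : borel M -> \bar R) :
  chart_density mu lam c rho -> measurable_fun (bdom c) F ->
  (forall x, chart_dom c x -> 0 <= F x)%E ->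
  (\int[mu]_(x in bdom c) F x =
   \int[lam]_(y in bimg c) (F (chart_inv c y) * (rho y)%:E))%E.
Proof.
move=> [srho rho0 muE] mF F0.
have oI : open (chart_img c) by exact: chart_img_open.
apply: (@ge0_integral_density _ _ _ _ _ mu lam (bdom c) (bimg c)
  (chart_inv c)) => //.
- exact: chart_dom_measurable.
- exact: open_borel.
- apply: measurable_fun_borel => // y yc; exact: chart_inv_continuous.
- by move=> y; exact: chart_inv_dom.
- apply: measurable_fun_borel_real => // y yc.
  exact: C_on_continuous (srho 0%N) yc.
- by move=> y yc; exact/ltW/rho0.
- move=> B mB Bc; rewrite muE// -chart_imageE.
  by rewrite (_ : chart_dom c `&` B = B)//; apply/setIidPr.
Qed.

Lemma chart_density_compact mu lam c rho (a : 'rV[R]_n) r :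
  is_lebesgue_measure lam -> chart_density mu lam c rho -> 0 < r ->
  box a r `<=` chart_img c -> (mu (chart_inv c @` box a r) < +oo)%E.
Proof.
move=> Hlam [srho rho0 muE] r0 ac.
have cK := chart_box_compact ac.
have oI : open (chart_img c) by exact: chart_img_open.
have mK : measurable (chart_inv c @` box a r : set (borel M)).
  apply: closed_borel; apply: compact_closed => //; exact: manifold_hausdorff.
rewrite muE//; last by move=> _ [y /ac yc <-]; exact: chart_inv_dom.
have -> : c @` (chart_inv c @` box a r) = box a r.
  apply/seteqP; split => [_ [_ [y ay <-] <-]|y ay].
    by rewrite chart_invK//; exact: ac.
  exists (chart_inv c y); [by exists y|by rewrite chart_invK//; exact: ac].
have crho y : chart_img c y -> {for y, continuous rho}.
  by move=> yc; exact: C_on_continuous (srho 0%N) yc.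
have [C C0 HC] := compact_bound (@box_compact _ _ a r)
  (fun y ay => crho _ (ac _ ay)).
have mbox : measurable (box a r : set (borel 'rV[R]_n)).
  by apply: closed_boxes_measurable; apply: closed_boxes_box; exact: ltW.
have mrho : measurable_fun (box a r : set (borel 'rV[R]_n)) (EFin \o rho).
  apply/measurable_EFinP.
  apply: (@measurable_funS _ _ _ _ (bimg c)) => //.
    exact (open_borel oI).
  exact (measurable_fun_borel_real oI crho).
apply: (@le_lt_trans _ _
  (\int[lam]_(y in (box a r : set (borel 'rV[R]_n))) (cst C%:E y))%E).
  apply: ge0_le_integral => //.
  - by move=> y /ac /rho0 /ltW; rewrite lee_fin.
  - by move=> y ay; rewrite lee_fin (le_trans (ler_norm _))// HC.
rewrite integral_cst// box_closed_box [X in (_ * X)%E]Hlam.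
  by rewrite -EFinM ltry.
by move=> i; rewrite !mxE; lra.
Qed.

(** For nonnegative integrands both sides become the same integral over the image of the chart. As
    [theta] is nonnegative, multiplying by it commutes with taking positive and negative parts,
    which gives the signed case. *)
Lemma density_ratio_integral (mu mu' : {measure set (borel M) -> \bar R})
    lam c rho rho' (theta : M -> R) (G : M -> R) :
  chart_density mu lam c rho -> chart_density mu' lam c rho' ->
  continuous theta -> (forall x, 0 <= theta x) ->
  (forall x, chart_dom c x -> rho' (c x) = theta x * rho (c x)) ->
  continuous G -> (forall x, ~ chart_dom c x -> G x = 0) ->
  (\int[mu']_(x in [set: borel M]) (G x)%:E =
   \int[mu]_(x in [set: borel M]) (G x * theta x)%:E)%E.
Proof.
move=> Hd Hd' ct t0 tE cG G0.
have [srho rho0 _] := Hd.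
have mt : measurable_fun [set: borel M] (EFin \o theta).
  apply/measurable_EFinP.
  by apply: (measurable_fun_borel_real openT) => x _; exact: ct.
have mG : measurable_fun [set: borel M] (EFin \o G).
  apply/measurable_EFinP.
  by apply: (measurable_fun_borel_real openT) => x _; exact: cG.
have ge0 (F : borel M -> \bar R) : measurable_fun [set: borel M] F ->
    (forall x, 0 <= F x)%E -> (forall x, ~ chart_dom c x -> F x = 0%E) ->
    (\int[mu']_(x in [set: borel M]) F x =
     \int[mu]_(x in [set: borel M]) (F x * (theta x)%:E))%E.
  move=> mF F0 FD.
  have restr (m : {measure set (borel M) -> \bar R}) (H : borel M -> \bar R) :
      (forall x, ~ chart_dom c x -> H x = 0%E) ->
      (\int[m]_(x in [set: borel M]) H x = \int[m]_(x in bdom c) H x)%E.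
    move=> H0; rewrite [RHS]integral_mkcond; apply: eq_integral => x _.
    by rewrite patchE; case: ifPn => // /negP xc; apply: H0 => h; apply/xc/mem_set.
  rewrite restr// [RHS]restr; last by move=> x xc; rewrite FD// mul0e.
  rewrite (chart_density_integral Hd')//; last exact: measurable_funTS.
  rewrite (chart_density_integral Hd); first last.
  - by move=> x _; rewrite mule_ge0 ?lee_fin.
  - by apply: emeasurable_funM; exact: measurable_funTS.
  apply: eq_integral => y /[!inE] yc.
  rewrite -muleA -EFinM -{2}(chart_invK yc) tE ?chart_invK//.
  exact: chart_inv_dom.
have E (F : borel M -> \bar R) : F = EFin \o (fun x => G x * theta x) ->
   (F^\+ = fun x => (EFin \o G)^\+ x * (theta x)%:E)%E /\
   (F^\- = fun x => (EFin \o G)^\- x * (theta x)%:E)%E.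
  move=> ->; split; apply/funext => x; rewrite ?funeposE ?funenegE /=.
    by rewrite -!EFin_max -EFinM -[in LHS](mul0r (theta x)) maxr_pMl.
  by rewrite -?EFinN -!EFin_max -EFinM -mulNr -[in LHS](mul0r (theta x)) maxr_pMl.
have [Ep En] := E _ erefl.
rewrite [LHS]integralE [RHS]integralE Ep En; congr (_ - _)%E.
- apply: ge0; [exact: measurable_funepos| |].
    by move=> x; exact: funepos_ge0.
  by move=> x xc; rewrite funeposE /= G0// maxxx.
- apply: ge0; [exact: measurable_funeneg| |].
    by move=> x; exact: funeneg_ge0.
  by move=> x xc; rewrite funenegE /= G0// oppr0 maxxx.
Qed.

End chart_measure.

(** * Integrability of continuous functions with compact support *)

Section compact_support.
Context {R : realType} {n : nat} {M : manifold R n}.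
Variables (mu : {measure set (borel M) -> \bar R}) (K : set M).
Hypotheses (cK : compact K) (muK : (mu K < +oo)%E).

Let mK : measurable (K : set (borel M)).
Proof.
by apply: closed_borel; apply: compact_closed => //; exact: manifold_hausdorff.
Qed.

Lemma integrable_compact_support (f : M -> R) : continuous f ->
  (forall x, ~ K x -> f x = 0) ->
  mu.-integrable [set: borel M] (EFin \o f).
Proof.
move=> cf f0.
have -> : EFin \o f = (EFin \o f) \_ K.
  apply/funext => x; rewrite patchE; case: ifPn => // /negP xK.
  by rewrite /= f0// => h; apply/xK/mem_set.
apply/(@integrable_mkcond _ _ _ mu K) => //.
apply: measurable_bounded_integrable => //.
  apply: measurable_funTS.
  by apply: (measurable_fun_borel_real openT) => x _; exact: cf.
have [C C0 HC] := compact_bound cK (fun x _ => cf x).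
exists C; split; first exact: num_real.
by move=> D CD x Kx; exact: le_trans (HC x Kx) (ltW CD).
Qed.

Lemma L2_compact_support (f : M -> R) : continuous f ->
  (forall x, ~ K x -> f x = 0) -> L2 mu f.
Proof.
move=> cf f0; rewrite /L2 /=; apply/andP; split.
  by apply/mem_set; apply: (measurable_fun_borel_real openT) => x _; exact: cf.
apply/mem_set; rewrite /= /finite_norm.
apply: (@lty_poweRy _ _ 2%R) => //; rewrite powR_Lnorm//.
have : mu.-integrable [set: borel M] (EFin \o (f * f)).
  apply: integrable_compact_support.
    by move=> x; apply: cvgM; exact: cf.
  by move=> x /f0 fx; rewrite -[LHS]/(f x * f x) fx mul0r.
move=> /integrableP[_]; congr (_ < _)%E; apply: eq_integral => x _.
rewrite /= -[(f * f) x]/(f x * f x) normrM -expr2 -powR_mulrn//.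
Qed.

End compact_support.

(** * The density of one smooth measure with respect to another *)

Section density_ratio.
Context {R : realType} {n : nat} {M : manifold R n}.
Implicit Types (mu : {measure set (borel M) -> \bar R}) (c : chart R n M).
Implicit Types (lam : {measure set (borel 'rV[R]_n) -> \bar R}).
Implicit Types (rho : 'rV[R]_n -> R).

Lemma chart_image_measurable c (B : set M) : measurable (B : set (borel M)) ->
  B `<=` chart_dom c -> measurable (c @` B : set (borel 'rV[R]_n)).
Proof.
move=> mB Bc; have -> : B = chart_dom c `&` B by apply/esym/setIidPr.
have oI : open (chart_img c) by exact: chart_img_open.
rewrite chart_imageE.
by apply: (measurable_fun_borel oI (@chart_inv_continuous _ _ _ c)) => //;
  exact: open_borel.
Qed.

Lemma chart_density_le mu (mu' : {measure set (borel M) -> \bar R}) lam c rho rho'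
    (s : R) (B : set (borel M)) :
  chart_density mu lam c rho -> chart_density mu' lam c rho' -> 0 <= s ->
  measurable B -> B `<=` chart_dom c ->
  (forall x, B x -> rho' (c x) <= s * rho (c x)) ->
  (mu' B <= s%:E * mu B)%E.
Proof.
move=> [srho rho0 muE] [srho' rho'0 mu'E] s0 mB Bc le.
have oI : open (chart_img c) by exact: chart_img_open.
have mcB := chart_image_measurable mB Bc.
have mrho (r : 'rV[R]_n -> R) : smooth_on (chart_img c) r ->
    measurable_fun (c @` B : set (borel 'rV[R]_n)) (EFin \o r).
  move=> sr; apply/measurable_EFinP.
  apply: (@measurable_funS _ _ _ _ (chart_img c : set (borel 'rV[R]_n))).
  - exact: open_borel.
  - by move=> _ [x /Bc xc <-]; exact: chart_img_map.
  - apply: (measurable_fun_borel_real oI) => y yc.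
    exact: C_on_continuous (sr 0%N) yc.
have pos (r : 'rV[R]_n -> R) : (forall y, chart_img c y -> 0 < r y) ->
    forall y, (c @` B) y -> (0 <= (r y)%:E)%E.
  by move=> r0 _ [x /Bc xc <-]; rewrite lee_fin ltW// r0//; exact: chart_img_map.
rewrite muE// mu'E// -ge0_integralZl//; [|exact: mrho|exact: pos].
apply: ge0_le_integral => //.
- exact: pos.
- exact: mrho.
- by apply: measurable_funeM; exact: mrho.
- by move=> _ [x Bx <-]; rewrite -EFinM lee_fin le.
Qed.

Lemma near_finite_measure mu lam c rho x : is_lebesgue_measure lam ->
  chart_density mu lam c rho -> chart_dom c x ->
  exists V : set M, [/\ open V, V x & (mu V < +oo)%E].
Proof.
move=> Hl Hd cx.
have oI : open (chart_img c) by exact: chart_img_open.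
have [r r0 rc] := open_box oI (chart_img_map cx).
have muK := chart_density_compact Hl Hd r0 rc.
set K := chart_inv c @` _ in muK.
exists (K^°); split; first exact: open_interior.
  have : \forall z \near x, chart_dom c z /\ box (c x) r (c z).
    apply: filterI; first exact: near_chart_dom.
    by apply: (chart_map_continuous cx); exact: box_nbhs.
  by apply: filterS => z [cz bz]; exists (c z) => //; exact: chart_mapK.
apply: le_lt_trans muK; apply: le_measure; last exact: interior_subset.
  by apply/mem_set; apply: open_borel; exact: open_interior.
apply/mem_set; apply: closed_borel; apply: compact_closed.
  exact: manifold_hausdorff.
exact: chart_box_compact.
Qed.

Lemma near_density_lt c rho rho' (s : R) x : chart_dom c x ->
  smooth_on (chart_img c) rho -> smooth_on (chart_img c) rho' ->
  rho' (c x) < s * rho (c x) ->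
  exists V : set M, [/\ open V, V x, V `<=` chart_dom c &
     forall z, V z -> rho' (c z) <= s * rho (c z)].
Proof.
move=> cx sr sr' lt.
have oI : open (chart_img c) by exact: chart_img_open.
pose q := cst s * rho + cst (-1) * rho'.
have cq z : chart_dom c z -> {for z, continuous (q \o c)}.
  move=> cz; apply: continuous_comp; first exact: chart_map_continuous.
  apply: (@C_on_continuous _ _ 0%N (chart_img c)); last exact: chart_img_map.
  by apply: C_onD => //; apply: C_onM => //; exact: C_on_cst.
exists (chart_dom c `&` (q \o c) @^-1` [set t | 0 < t]); split.
- exact (open_preimage_on (@chart_dom_open _ _ _ c) cq (@open_gt R 0)).
- split=> //=; rewrite -[q _]/(s * rho (c x) + -1 * rho' (c x)).
  by rewrite mulN1r subr_gt0.
- by move=> z [].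
- move=> z [_ /=]; rewrite -[q _]/(s * rho (c z) + -1 * rho' (c z)).
  by rewrite mulN1r subr_gt0 => /ltW.
Qed.

(** If the ratio p in [c] were smaller than the ratio q in [d], then for p < s < t < q a small
    neighbourhood V of [x] would satisfy mu'(V) <= s mu(V), by the chart [c], and t mu(V) <= mu'(V),
    by the chart [d]. This is absurd as 0 < mu(V) < +oo. Exchanging the charts yields equality. *)
Lemma density_ratio_le mu (mu' : {measure set (borel M) -> \bar R}) lam
    c d rhoc rhoc' rhod rhod' x : is_lebesgue_measure lam -> full_support mu ->
  chart_density mu lam c rhoc -> chart_density mu' lam c rhoc' ->
  chart_density mu lam d rhod -> chart_density mu' lam d rhod' ->
  chart_dom c x -> chart_dom d x ->
  rhod' (d x) / rhod (d x) <= rhoc' (c x) / rhoc (c x).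
Proof.
move=> Hl fs Hc Hc' Hd Hd' cx dx.
have [src rc0 _] := Hc; have [src' rc'0 _] := Hc'.
have [srd rd0 _] := Hd; have [srd' rd'0 _] := Hd'.
set p := rhoc' (c x) / rhoc (c x); set q := rhod' (d x) / rhod (d x).
have pc0 := rc0 _ (chart_img_map cx); have pd0 := rd0 _ (chart_img_map dx).
have p0 : 0 < p by rewrite divr_gt0// rc'0//; exact: chart_img_map.
rewrite leNgt; apply/negP => pq.
(* The points at one third and two thirds of the way from [p] to [q]. *)
pose s := (p + p + q) / 3; pose t := (p + q + q) / 3.
have ps : p < s by rewrite /s; lra.
have st : s < t by rewrite /s /t; lra.
have tq : t < q by rewrite /t; lra.
have s0 : 0 < s by exact: lt_trans ps.
have t0 : 0 < t by exact: lt_trans st.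
have [V1 [oV1 V1x V1c le1]] : exists V : set M, [/\ open V, V x,
    V `<=` chart_dom c & forall z, V z -> rhoc' (c z) <= s * rhoc (c z)].
  by apply: near_density_lt => //; rewrite -ltr_pdivrMr.
have [V2 [oV2 V2x V2d le2]] : exists V : set M, [/\ open V, V x,
    V `<=` chart_dom d & forall z, V z -> rhod (d z) <= t^-1 * rhod' (d z)].
  by apply: near_density_lt => //; rewrite mulrC ltr_pdivlMr// mulrC -ltr_pdivlMr.
have [V3 [oV3 V3x muV3]] := near_finite_measure Hl Hc cx.
pose V := V1 `&` V2 `&` V3.
have oV : open V by apply: openI => //; exact: openI.
have mV : measurable (V : set (borel M)) by exact: open_borel.
have muV : (0 < mu V)%E by apply: fs => //; exists x.
have muVoo : (mu V < +oo)%E.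
  apply: le_lt_trans muV3; apply: le_measure; [exact/mem_set| |].
    by apply/mem_set; exact: open_borel.
  by move=> z [].
have h1 : (mu' V <= s%:E * mu V)%E.
  apply: (chart_density_le Hc Hc') => //; first exact: ltW.
    by move=> z [[/V1c]].
  by move=> z [[/le1]].
have h2 : (mu V <= t^-1%:E * mu' V)%E.
  apply: (chart_density_le Hd' Hd) => //; first by rewrite invr_ge0 ltW.
    by move=> z [[_ /V2d]].
  by move=> z [[_ /le2]].
have muVf : mu V \is a fin_num by rewrite ge0_fin_numE// ltW.
have : (mu V <= t^-1%:E * (s%:E * mu V))%E.
  by apply: (le_trans h2); rewrite lee_wpmul2l// lee_fin invr_ge0 ltW.
rewrite -(fineK muVf) -!EFinM lee_fin mulrA.
have m0 : 0 < fine (mu V) by rewrite fine_gt0// muV muVoo.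
rewrite -[leLHS]mul1r ler_pM2r// leNgt => /negP; apply.
by rewrite mulrC ltr_pdivrMr// mul1r.
Qed.

Lemma smooth_density_ratio mu (mu' : {measure set (borel M) -> \bar R}) :
  full_support mu -> smooth_positive_measure mu -> smooth_positive_measure mu' ->
  exists theta : M -> R, [/\ smooth theta, forall x, 0 < theta x &
    forall c, atlas c -> exists lam rho rho',
      [/\ is_lebesgue_measure lam, chart_density mu lam c rho,
          chart_density mu' lam c rho' &
          forall x, chart_dom c x -> rho' (c x) = theta x * rho (c x)]].
Proof.
move=> fs [lam Hl Hd] [lam' Hl' Hd'].
have /choice[rho Hrho] c : exists r, atlas c -> chart_density mu lam c r.
  have [/Hd[r Hr]|nc] := pselect (atlas c); first by exists r.
  by exists (cst 0).
have /choice[rho' Hrho'] c : exists r, atlas c -> chart_density mu' lam c r.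
  have [ac|nc] := pselect (atlas c); last by exists (cst 0).
  (* The density of [mu'] with respect to [lam'] serves for [lam] as well, the two being equal on
     Borel sets. *)
  have [r [sr r0 Hr]] := Hd' c ac; exists r => _; split=> // B mB Bc.
  rewrite Hr//; apply: eq_measure_integral => A mA _.
  exact: lebesgue_measure_unique_rV.
have /choice[ch Hch] (x : M) : exists c, atlas c /\ chart_dom c x.
  by have [c ac cx] := atlas_cover x; exists c.
pose theta x := rho' (ch x) (ch x x) / rho (ch x) (ch x x).
(* [theta] is defined by an arbitrary choice of chart at each point; this independence of the chart
   is what makes it smooth. *)
have thetaE c x : atlas c -> chart_dom c x -> theta x = rho' c (c x) / rho c (c x).
  move=> ac cx; have [ac' cx'] := Hch x; apply/eqP; rewrite eq_le.
  by rewrite !(density_ratio_le (mu := mu) (mu' := mu') (lam := lam))//;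
    first [exact: Hrho|exact: Hrho'].
exists theta; split.
- move=> c ac k; have [sr r0 _] := Hrho c ac; have [sr' r'0 _] := Hrho' c ac.
  have oI : open (chart_img c) by exact: chart_img_open.
  apply: (@C_on_ext _ _ _ _ (rho' c * (fun y => (rho c y)^-1))) => //.
    move=> y yc; rewrite /= (thetaE c)//; last exact: chart_inv_dom.
    by rewrite chart_invK.
  apply: C_onM => //; apply: C_onV => // y yc; rewrite gt_eqF// r0//.
- move=> x; have [ac cx] := Hch x; have [_ r0 _] := Hrho _ ac.
  have [_ r'0 _] := Hrho' _ ac.
  by rewrite divr_gt0// ?r0 ?r'0//; exact: chart_img_map.
- move=> c ac; exists lam, (rho c), (rho' c); split=> //.
  + exact: Hrho.
  + exact: Hrho'.
  + move=> x cx; rewrite (thetaE c)// divfK// gt_eqF//.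
    by have [_ + _] := Hrho c ac; apply; exact: chart_img_map.
Qed.

(** Second countability provides a countable cover by open sets lying in chart domains, and two
    measures that agree on the measurable subsets of each member of such a cover are equal. *)
Lemma proportional_measures mu (mu' : {measure set (borel M) -> \bar R}) (s : R) :
  0 < s ->
  (forall c, atlas c -> forall B : set (borel M), measurable B ->
     B `<=` chart_dom c -> mu' B = (s%:E * mu B)%E) ->
  forall B : set (borel M), measurable B -> mu' B = (s%:E * mu B)%E.
Proof.
move=> s0 loc B mB.
have [BB cBB [oBB bBB]] := @manifold_second_countable _ _ M.
have /countable_injP[f finj] := cBB.
pose Q := [set U : set M | BB U /\ exists2 c, atlas c & U `<=` chart_dom c].
pose F k := \bigcup_(U in Q `&` [set U | f U = k]) U.
have oF k : open (F k).
  by apply: bigcup_open => U [[/oBB]].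
have Fc k : F k = set0 \/ exists2 c, atlas c & F k `<=` chart_dom c.
  have [->|/set0P[x [U [[BU [c ac Uc]] fU] Ux]]] := eqVneq (F k) set0; first by left.
  right; exists c => // z [W [[BW _] fW] Wz]; apply: Uc.
  by rewrite -(finj _ _ (mem_set BW) (mem_set BU))// fU.
have Fcover : \bigcup_k F k = [set: M].
  apply/seteqP; split => // x _; have [c ac cx] := atlas_cover x.
  have [U [BU Ux] Uc] := bBB x _ (near_chart_dom cx).
  by exists (f U) => //; exists U => //; split=> //; split=> //; exists c.
have sE (A : set (borel M)) : mscale (NngNum (ltW s0)) mu A = (s%:E * mu A)%E by [].
rewrite -sE.
apply: (@g_sigma_algebra_measure_unique_cover _ _ (borel M) (@open M) _ F) => //.
  by move=> U oU; exact: open_borel.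
move=> k A mA; rewrite [RHS]sE.
have [->|[c ac FkC]] := Fc k; first by rewrite !set0I !measure0 mule0.
apply: (loc c ac); last by move=> x [/FkC].
by apply: measurableI => //; exact: open_borel.
Qed.

End density_ratio.

(** * The semigroup and the carré du champ *)

Section semigroup.
Context {R : realType} {n : nat} {M : manifold R n}.

(** The set where [G] is nonzero is open by continuity and null because the integral vanishes; full
    support then leaves it empty. *)
Lemma eq0_of_integral_eq0 (mu : {measure set (borel M) -> \bar R}) (G : M -> R) :
  full_support mu -> continuous G -> (forall x, 0 <= G x) ->
  mu.-integrable [set: borel M] (EFin \o G) ->
  \int[mu]_(x in [set: borel M]) G x = 0 -> forall x, G x = 0.
Proof.
move=> fs cG G0 iG intG x; apply/eqP; apply: contrapT => /negP Gx.
pose W : set M := [set z | G z != 0].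
have oW : open W.
  have -> : W = G @^-1` (~` [set 0]).
    by apply/seteqP; split => z /= /eqP.
  by apply: open_comp => [z _|]; [exact: cG|exact/closed_openC/closed_eq].
have mW : measurable (W : set (borel M)) by exact: open_borel.
have : (0 < mu (W : set (borel M)))%E by apply: fs => //; exists x.
have mG : measurable_fun [set: borel M] (EFin \o G) by case/integrableP: iG.
have intG0 : (\int[mu]_(x in [set: borel M]) `|(EFin \o G) x| = 0)%E.
  have -> : (\int[mu]_(x in [set: borel M]) `|(EFin \o G) x| =
             \int[mu]_(x in [set: borel M]) (G x)%:E)%E.
    by apply: eq_integral => z _; rewrite /= ger0_norm.
  by rewrite -[LHS]fineK ?[fine _]intG//; exact: integrable_fin_num iG.
have [ae0 _] := ae_eq_integral_abs mu measurableT mG.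
have := ae0 intG0; rewrite /ae_eq /= => -[N [mN muN0 subN]].
suff -> : (mu (W : set (borel M)) = 0)%E by rewrite ltxx.
apply: (subset_measure0 mW mN) => // z /= Gz; apply: subN => /= h.
by move: (h I) => /= -[Gz0]; rewrite /W /= Gz0 eqxx in Gz.
Qed.

Variables (mu mu' : {measure set (borel M) -> \bar R}).
Variables (P P' : R -> (M -> R) -> (M -> R)) (theta : M -> R).
Hypotheses (fs : full_support mu) (aP : acts_on_smooth P).
Hypotheses (symP : symmetric_semigroup mu P) (symP' : symmetric_semigroup mu' P').
Hypothesis eqP' : forall t f, 0 <= t -> smooth f -> P' t f = P t f.
Hypotheses (stheta : smooth theta) (theta0 : forall x, 0 < theta x).

(* Both symmetries, tested against f supported near x, say that
   P_t (theta h) and theta P_t h have the same integral against f. *)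
Lemma semigroup_commutes_ratio lam c rho rho' (r : R) (x : M) (h : M -> R) t :
  atlas c -> is_lebesgue_measure lam ->
  chart_density mu lam c rho -> chart_density mu' lam c rho' ->
  (forall z, chart_dom c z -> rho' (c z) = theta z * rho (c z)) ->
  0 < r -> box (c x) r `<=` chart_img c -> chart_dom c x ->
  smooth h -> (forall z, ~ (chart_inv c @` box (c x) r) z -> h z = 0) ->
  0 <= t -> P t (theta * h) x = theta x * P t h x.
Proof.
move=> ac Hl Hd Hd' rhoE r0 rc cx sh h0 t0.
set K := chart_inv c @` _ in h0.
have cK : compact K by exact: chart_box_compact.
have muK := chart_density_compact Hl Hd r0 rc.
have mu'K := chart_density_compact Hl Hd' r0 rc.
have sth : smooth (theta * h) by exact: smoothM.
have sPth : smooth (P t (theta * h)) by exact: semigroup_smooth.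
have sPh : smooth (P t h) by exact: semigroup_smooth.
have stPh : smooth (theta * P t h) by exact: smoothM.
pose u := P t (theta * h) - theta * P t h.
have su : smooth u by exact: smoothB.
pose b := bump c (c x) r.
have sb : smooth b by exact: bump_smooth.
have b0 z : ~ K z -> b z = 0 by exact: bump_out.
(* With this test function, equality of the integrals of P_t (theta h) f and theta (P_t h) f says
   that the continuous nonnegative function b u^2 has integral 0. The factor [b] brings the support
   into [K] and is positive at [x]. *)
pose f := b * u.
have sf : smooth f by exact: smoothM.
have f0 z : ~ K z -> f z = 0 by move=> /b0 bz; rewrite -[f z]/(b z * u z) bz mul0r.
have th0 z : ~ K z -> (theta * h) z = 0.
  by move=> /h0 hz; rewrite -[LHS]/(theta z * h z) hz mulr0.
have sPf : smooth (P t f) by exact: semigroup_smooth.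
have L2K (m : {measure set (borel M) -> \bar R}) g : (m K < +oo)%E -> smooth g ->
    (forall z, ~ K z -> g z = 0) -> L2 m g.
  move=> mK sg g0; apply: (L2_compact_support cK) => //.
  exact: smooth_continuous.
have Kc z : ~ chart_dom c z -> ~ K z by move=> zc /(bump_support_dom rc).
(* Only the product is required to vanish off [K]: one of the factors will be [P t f] or [P t h],
   whose support is not controlled. *)
have transfer g1 g2 : smooth g1 -> smooth g2 ->
    (forall z, ~ K z -> g1 z * g2 z = 0) ->
    L2dot mu' g1 g2 = \int[mu]_(z in [set: borel M]) (g1 z * g2 z * theta z).
  move=> s1 s2 g0; rewrite /L2dot /Rintegral; congr fine.
  apply: (density_ratio_integral Hd Hd') => //.
  - exact: smooth_continuous.
  - by move=> z; exact: ltW.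
  - exact: (smooth_continuous (smoothM s1 s2)).
  - by move=> z /Kc; exact: g0.
(* Symmetry for [mu] on the left and for [mu'] on the right moves P_t onto [f]; both sides become
   the integral of theta h P_t f against [mu]. *)
have key : L2dot mu (P t (theta * h)) f =
    \int[mu]_(z in [set: borel M]) (P t h z * f z * theta z).
  rewrite symP//; [|exact: L2K|exact: L2K].
  rewrite -transfer//; last by move=> z /f0 ->; rewrite mulr0.
  rewrite -[in RHS]eqP'// symP'//; [|exact: L2K|exact: L2K].
  rewrite eqP'// transfer//; last by move=> z /h0 ->; rewrite mul0r.
  congr Rintegral; apply/funext => z.
  by rewrite -[(theta * h) z]/(theta z * h z); ring.
have iK g : smooth g -> (forall z, ~ K z -> g z = 0) ->
    mu.-integrable [set: borel M] (EFin \o g).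
  move=> sg g0; apply: (integrable_compact_support cK) => //.
  exact: smooth_continuous.
have int0 : \int[mu]_(z in [set: borel M]) (b * (u * u)) z = 0.
  transitivity (\int[mu]_(z in [set: borel M])
      ((P t (theta * h) * f) z - (theta * P t h * f) z)).
    congr Rintegral; apply/funext => z; rewrite -[f]/(b * u).
    rewrite -[LHS]/(b z * (u z * u z)).
    rewrite -[RHS]/(P t (theta * h) z * (b z * u z) -
      theta z * P t h z * (b z * u z)).
    by rewrite -mulrBl -[P t (theta * h) z - theta z * P t h z]/(u z); ring.
  rewrite RintegralB//.
  - apply/eqP; rewrite subr_eq0; apply/eqP.
    transitivity (L2dot mu (P t (theta * h)) f) => //.
    rewrite key; congr Rintegral; apply/funext => z.
    by rewrite -[RHS]/(theta z * P t h z * f z); ring.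
  - apply: iK; first exact: smoothM.
    by move=> z /f0 fz; rewrite -[LHS]/(P t (theta * h) z * f z) fz mulr0.
  - apply: iK; first exact: smoothM.
    by move=> z /f0 fz; rewrite -[LHS]/(theta z * P t h z * f z) fz mulr0.
have sbuu : smooth (b * (u * u)) by do 2 apply: smoothM => //.
have buu0 z : 0 <= (b * (u * u)) z.
  rewrite -[X in _ <= X]/(b z * (u z * u z)) mulr_ge0 ?bump_ge0//.
  by rewrite -expr2 sqr_ge0.
have ibuu : mu.-integrable [set: borel M] (EFin \o (b * (u * u))).
  by apply: iK => // z /b0 bz; rewrite -[LHS]/(b z * (u z * u z)) bz mul0r.
have := eq0_of_integral_eq0 fs (smooth_continuous sbuu) buu0 ibuu int0 x.
have bx : 0 < b x by exact: bump_center_gt0.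
rewrite -[LHS]/(b x * (u x * u x)) => /eqP.
by rewrite !mulf_eq0 gt_eqF//= orbb subr_eq0 => /eqP.
Qed.

Hypotheses (calc : smooth_diffusion_calculus P) (nd : Defs.nondegenerate P).

(* Gamma(theta, theta h) is computed by the Leibniz rule and by
   P_t (theta h) = theta P_t h; comparing, h Gamma(theta, theta) vanishes. *)
Lemma differential_ratio lam c rho rho' (x : M) :
  atlas c -> is_lebesgue_measure lam ->
  chart_density mu lam c rho -> chart_density mu' lam c rho' ->
  (forall z, chart_dom c z -> rho' (c z) = theta z * rho (c z)) ->
  chart_dom c x -> differential c theta x = 0.
Proof.
move=> ac Hl Hd Hd' rhoE cx.
have oI : open (chart_img c) by exact: chart_img_open.
have [r r0 rc] := open_box oI (chart_img_map cx).
pose b := bump c (c x) r.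
have sb : smooth b by exact: bump_smooth.
have b0 z : ~ (chart_inv c @` box (c x) r) z -> b z = 0 by exact: bump_out.
have stb : smooth (theta * b) by exact: smoothM.
have tb0 z : ~ (chart_inv c @` box (c x) r) z -> (theta * b) z = 0.
  by move=> /b0 bz; rewrite -[LHS]/(theta z * b z) bz mulr0.
have com h t := @semigroup_commutes_ratio lam c rho rho' r x h t ac Hl Hd Hd' rhoE
  r0 rc cx.
(* Commutation is used for [b] and for [theta * b], both supported in the box. The factor
   [P t theta x] occurs on both sides and is left as it is. *)
have G1 : carre_du_champ P theta (theta * b) x =
    theta x * carre_du_champ P theta b x.
  rewrite /carre_du_champ; apply: cvg_lim => //.
  have cv := @Gamma_cvg _ _ _ _ calc _ _ x stheta sb.
  have H := cvgM (@cvg_cst _ (theta x) _ (0 : R)^'+ _) cv.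
  have E : {near (0 : R)^'+,
    (cst (theta x) * (fun t => (2 * t)^-1 *
       (P t (theta * b) x - P t theta x * P t b x)))
    =1 (fun t => (2 * t)^-1 *
      (P t (theta * (theta * b)) x - P t theta x * P t (theta * b) x))}.
    near=> t; have t0 : 0 <= t by near: t; exact: nbhs_right_ge.
    rewrite /= !com// -[LHS]/(theta x * ((2 * t)^-1 *
      (P t (theta * b) x - P t theta x * P t b x))) com//.
    by ring.
  have FF : Filter (0 : R)^'+ by typeclasses eauto.
  exact (cvg_trans (near_eq_cvg E) (H FF FF)).
have G2 : carre_du_champ P theta (theta * b) x =
    theta x * carre_du_champ P theta b x + b x * carre_du_champ P theta theta x.
  by rewrite (Gamma_leibniz_r calc).
have bx : 0 < b x by exact: bump_center_gt0.
have Gtt : carre_du_champ P theta theta x = 0.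
  move: G2; rewrite G1 => /eqP; rewrite -subr_eq0 opprD addNKr oppr_eq0.
  by rewrite mulf_eq0 gt_eqF// => /eqP.
have : eq_differential x theta 0.
  by apply: contrapT => /(nd stheta); rewrite Gtt ltxx.
move=> /(_ c ac cx) ->; apply/rowP => i; rewrite !mxE.
by rewrite (_ : 0 \o chart_inv c = cst 0)// derive_cst.
Unshelve. all: by end_near. Qed.

End semigroup.

(** * The carré du champ determines the metric *)

Section metric.
Context {R : realType} {n : nat} {M : manifold R n}.

Lemma carre_du_champ_eq (P P' : R -> (M -> R) -> (M -> R)) f h (x : M) :
  (forall t f, 0 <= t -> smooth f -> P' t f = P t f) -> smooth f -> smooth h ->
  carre_du_champ P' f h x = carre_du_champ P f h x.
Proof.
move=> PP' sf sh; rewrite /carre_du_champ; congr (lim _).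
have E : {near (0 : R)^'+,
   (fun t => (2 * t)^-1 * (P t (f * h) x - P t f x * P t h x)) =1
   (fun t => (2 * t)^-1 * (P' t (f * h) x - P' t f x * P' t h x))}.
  near=> t; have t0 : 0 <= t by near: t; exact: nbhs_right_ge.
  by rewrite !PP'//; exact: smoothM.
have FF : Filter (0 : R)^'+ by typeclasses eauto.
(* The two difference quotients agree only for t >= 0, so what is proved equal is their image
   filters at 0 from the right, by two inclusions. *)
apply/seteqP; split; last exact (near_eq_cvg E).
have E' : {near (0 : R)^'+,
   (fun t => (2 * t)^-1 * (P' t (f * h) x - P' t f x * P' t h x))
   =1 (fun t => (2 * t)^-1 * (P t (f * h) x - P t f x * P t h x))}.
  by apply: filterS E => t; exact: esym.
exact (near_eq_cvg E').
Unshelve. all: by end_near. Qed.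

Lemma recovered_metric_eq (P P' : R -> (M -> R) -> (M -> R))
    (g g' : riemannian_metric M) (c : chart R n M) (x : M) :
  (forall t f, 0 <= t -> smooth f -> P' t f = P t f) ->
  recovered_metric P g -> recovered_metric P' g' ->
  atlas c -> chart_dom c x -> g c x = g' c x.
Proof.
(* The carré du champ sees the inverse matrices only. Their entry (i, j) is obtained from the bump
   coordinates [i] and [j], up to the square of the bump value at [x], which is nonzero. *)
move=> PP' rg rg' ac cx; rewrite -[g c x]invmxK -[g' c x]invmxK; congr invmx.
have oI : open (chart_img c) by exact: chart_img_open.
have [r r0 rc] := open_box oI (chart_img_map cx).
have bx : bump c (c x) r x != 0 by rewrite gt_eqF// bump_center_gt0.
apply/matrixP => i j.
have si := bump_coord_smooth ac rc i; have sj := bump_coord_smooth ac rc j.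
have entry (b : R) (B : 'M[R]_n) :
    ((b *: basis_vector i) *m B *m (b *: basis_vector j)^T) 0 0 = b * (b * B i j).
  rewrite linearZ/= -scalemxAr -!scalemxAl /basis_vector -rowE trmx_delta -colE.
  by rewrite !mxE.
have := carre_du_champ_eq x PP' si sj.
rewrite (rg _ _ si sj c x ac cx) (rg' _ _ si sj c x ac cx) /dual_metric.
by rewrite !differential_bump_coord// !entry => /(mulfI bx)/(mulfI bx).
Qed.

Lemma smooth_self_map_id : smooth_self_map (@id M).
Proof.
split; first by move=> x; exact: cvg_id.
by move=> c d ac ad; exact: atlas_compatible.
Qed.

End metric.

Theorem corollary4p9 (R : realType) (n : nat) (M : manifold R n)
    (mu mu' : {sigma_finite_measure set (borel M) -> \bar R})
    (P P' : R -> (M -> R) -> (M -> R)) (A A' : set (M -> R))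
    (g g' : riemannian_metric M) :
  connected [set: M] ->
  diffusion mu P A -> recovered_metric P g ->
  diffusion mu' P' A' -> recovered_metric P' g' ->
  (forall t f, 0 <= t -> smooth f -> P' t f = P t f) ->
  (exists F : M -> M, riemannian_isometry g g' F) /\
  (forall x : M, exists2 c : R, 0 < c &
     forall B : set (borel M), measurable B ->
       B `<=` connected_component [set: M] x -> mu' B = (c%:E * mu B)%E).
Proof.
move=> conM D rg D' rg' PP'; split.
  exists id; split; [exact: smooth_self_map_id| |].
    by exists id; split => //; exact: smooth_self_map_id.
  move=> c d x ac ad cx dx J.
  (* For the identity map, [J] is the Jacobian of the change of charts, and once the two metrics
     agree in [d] the pullback condition is the tensoriality of [g]. *)
  rewrite -(recovered_metric_eq PP' rg rg' ad dx).
  exact: (metric_tensorial g ac ad cx dx).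
have [theta [st t0 tE]] := smooth_density_ratio (diffusion_full_support D)
  (diffusion_measure D) (diffusion_measure D').
have dtheta c x : atlas c -> chart_dom c x -> differential c theta x = 0.
  move=> ac cx; have [lam [rho [rho' [Hl Hd Hd' rhoE]]]] := tE c ac.
  exact: (differential_ratio (diffusion_full_support D) (diffusion_smooth D)
    (diffusion_symmetric D) (diffusion_symmetric D') PP' st t0
    (diffusion_calculus D) (diffusion_nondegenerate D) ac Hl Hd Hd' rhoE cx).
have tcst := constant_of_differential conM st dtheta.
move=> x; exists (theta x) => // B mB _.
apply: proportional_measures => // c ac C mC Cc.
have [lam [rho [rho' [Hl Hd Hd' rhoE]]]] := tE c ac.
(* As [theta] is constant, the two densities in [c] are proportional; the two inequalities compare
   the measures with the factor [theta x] and with its inverse. *)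
apply/eqP; rewrite eq_le; apply/andP; split.
  apply: (chart_density_le Hd Hd') => //; first exact: ltW.
  by move=> z /Cc /rhoE ->; rewrite (tcst z x).
rewrite -lee_pdivlMl//; apply: (chart_density_le Hd' Hd) => //.
  by rewrite invr_ge0 ltW.
by move=> z /Cc /rhoE ->; rewrite (tcst z x) mulKf// gt_eqF.
Qed.
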